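(* Let a set $X$ of cycles be called a cycle obstruction set for balanced $2$-partitionability if there exists a nonnegative integer $D$ such that every planar graph containing none of the cycles in $X$ as a subgraph is $(D,D)$-colorable. Then the inclusion-wise minimal cycle obstruction sets for balanced $2$-partitionability are exactly $\{C_{2i+1} : i \ge 1\}$ (the set of all odd cycles) and $\{C_4\}$.
   Context: All graphs are finite and simple. $C_k$ denotes the cycle of length $k$; cycles are considered up to isomorphism, so a set of cycles is determined by the set of their lengths. For nonnegative integers $k,d_1,\dots,d_k$, a graph is $(d_1,\dots,d_k)$-colorable if its vertex set can be partitioned into $k$ parts $V_1,\dots,V_k$ such that $V_i$ induces a subgraph of maximum degree at most $d_i$ for every $i$. A class of graphs is balanced $k$-partitionable if there is a nonnegative integer $D$ such that every graph in the class is $(D,\dots,D)$-colorable (tuple of length $k$). A set $X$ of cycles is a cycle obstruction set of a class $\mathcal C$ of planar graphs if every planar graph containing no cycle of $X$ as a subgraph belongs to $\mathcal C$; here $\mathcal C$ is the (balanced $2$-partitionable) class described in the claim. *)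

(* Defs.v *)
From HB Require Import structures.
From mathcomp Require Import all_boot all_order all_algebra.
From mathcomp Require Import all_classical all_reals topology normedtype.

Set Implicit Arguments.
Unset Strict Implicit.
Unset Printing Implicit Defensive.

Import Order.TTheory GRing.Theory Num.Theory.
Import numFieldNormedType.Exports.

Local Open Scope classical_set_scope.
Local Open Scope ring_scope.

Record sgraph := SGraph {
  vertex :> finType;
  adj : rel vertex;
  adj_sym : symmetric adj;
  adj_irrefl : irreflexive adj }.

Arguments adj {s}.

Definition edges (G : sgraph) : {set {set G}} :=
  [set E : {set G} | [exists u, exists v, adj u v && (E == [set u; v])]]%SET.

Definition is_arc (R : realType) (A : set (R * R)) (x y : R * R) : Prop :=
  exists f : R -> R * R,
    [/\ {within `[0, 1], continuous f},
        {in `[0, 1] &, injective f},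
        f 0 = x, f 1 = y & f @` `[0, 1] = A].

(* [pos] places the vertices and [arc E] is the closed arc drawn for the edge
   [E]. By the last two clauses, arcs of distinct edges can only meet in the
   image of a common endpoint. *)
Definition planar (R : realType) (G : sgraph) : Prop :=
  exists (pos : G -> R * R) (arc : {set G} -> set (R * R)),
    [/\ injective pos,
        forall u v : G, adj u v -> is_arc (arc [set u; v]%SET) (pos u) (pos v),
        forall (E : {set G}) (w : G),
          E \in edges G -> arc E (pos w) -> w \in E
      & forall E F : {set G}, E \in edges G -> F \in edges G -> E != F ->
          arc E `&` arc F `<=` range pos].

(* For [3 <= k]: [G] has a subgraph isomorphic to the cycle of length [k]. *)
Definition contains_cycle (G : sgraph) (k : nat) : Prop :=
  exists c : seq G, size c = k /\ ucycle adj c.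

(* [c] sends a vertex to the index of its part; parts may be empty. *)
Definition colorable (k : nat) (d : 'I_k -> nat) (G : sgraph) : Prop :=
  exists c : G -> 'I_k,
    forall v : G, (#|[set w | adj v w & c w == c v]%SET| <= d (c v))%N.

Definition balanced_partitionable (k : nat) (C : sgraph -> Prop) : Prop :=
  exists D : nat, forall G : sgraph, C G -> colorable (fun _ : 'I_k => D) G.

(* A set of cycles is represented by the set of their lengths. *)
Definition cycle_set (X : set nat) : Prop := X `<=` [set k | (3 <= k)%N].

Definition obstruction_set (R : realType) (X : set nat) : Prop :=
  cycle_set X /\
  balanced_partitionable 2
    (fun G => planar R G /\ forall k, X k -> ~ contains_cycle G k).

Definition minimal_obstruction_set (R : realType) (X : set nat) : Prop :=
  obstruction_set R X /\
  forall Y : set nat, obstruction_set R Y -> Y `<=` X -> Y = X.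

(* Main.v *)
Require Import Defs.
From HB Require Import structures.
From mathcomp Require Import all_boot all_order all_algebra.
From mathcomp Require Import all_classical all_reals topology normedtype.
From mathcomp Require Import ring lra zify.
From Stdlib Require Import Btauto.

(* Planarity enters only through the non-planarity of K5, in the following weak
   form: the ten edges of K5 cannot be drawn by curves such that edges without
   common endpoint are disjoint. For disjoint curves e and f, the difference
   e(s) - f(t) never vanishes, so it has winding number 0 along the boundary of
   the square; modulo 2, and with the vertices ordered lexicographically, this
   says that n(a,e) + n(b,e) + n(u,f) + n(v,f), for e = uv and f = ab, is 1
   exactly if the endpoints of e and f interleave, where n(a,e) counts how often
   e crosses the horizontal ray to the left of a. Over the 15 pairs of disjoint
   edges every n(a,e) is summed twice, while 5 pairs interleave.

   Such weak drawings survive edge contraction (concatenate curves), so Mader's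
   argument bounds the average degree of planar graphs. If a planar graph
   without 4-cycles had minimum degree at least 2 and no edge with two ends of
   bounded degree, the vertices of small degree would give distinct edges
   (subdivided once) of a planar graph on the few vertices of large degree, too
   many of them. Deleting an edge at a vertex of degree 1 or an edge with both
   ends of bounded degree then colours planar graphs without 4-cycles by
   induction; graphs without odd cycles are bipartite.

   Conversely, for each odd k = 2i+1 and each D there is a planar graph that is
   not (D,D)-colourable and all of whose cycles have length 4 or k: 2D+1 common
   neighbours force two vertices to have the same colour, and D+1 chains of i
   such gadgets start at a common hub, the last vertex of each chain being
   adjacent to the hub. *)

Set Implicit Arguments.
Unset Strict Implicit.
Unset Printing Implicit Defensive.

Import Order.TTheory GRing.Theory Num.Theory.
Import numFieldNormedType.Exports.

(** * Winding numbers modulo 2 *)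

Section Winding.
Local Open Scope ring_scope.
Variable R : realType.
Implicit Types (z p q u v a b : R * R) (s r : seq (R * R)).

Definition near_pt (e : R) p q : bool :=
  (`|p.1 - q.1| < e) && (`|p.2 - q.2| < e).

(** The positive x-axis is included so that exactly one of [z] and [- z] is upper for nonzero [z];
    on differences this is a lexicographic order of points. *)
Definition upper z : bool := (0 < z.2) || ((z.2 == 0) && (0 < z.1)).

(* For steps that are short compared with the distance to the origin, [wind] is
   the parity of the number of crossings of the negative x-axis. *)
Definition cross z z' : bool := (upper z (+) upper z') && (z.1 < 0).

Fixpoint wind z s : bool :=
  if s is z' :: s' then cross z z' (+) wind z' s' else false.

Lemma upperN u a (e : R) : 0 < e -> ~~ near_pt e u a ->
  upper (a - u) = ~~ upper (u - a).
Proof.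
case: u a => [u1 u2] [a1 a2] e0; rewrite /near_pt /upper /=.
have [h|h|h] := ltgtP u2 a2.
- by have -> : (0 < a2 - u2) = true; [lra|have -> : (0 < u2 - a2) = false;
    [lra|have -> : (u2 - a2 == 0) = false by apply/eqP; lra]].
- by have -> : (0 < a2 - u2) = false; [lra|have -> : (0 < u2 - a2) = true;
    [lra|have -> : (a2 - u2 == 0) = false by apply/eqP; lra]].
- rewrite {}h subrr eqxx ltxx normr0 e0 andbT /= -leNgt => h.
  have [g|g|g] := ltgtP u1 a1.
  + by have -> : (0 < a1 - u1) = true; [lra|have -> : (0 < u1 - a1) = false by lra].
  + by have -> : (0 < a1 - u1) = false; [lra|have -> : (0 < u1 - a1) = true by lra].
  + by move: h; rewrite g subrr normr0; lra.
Qed.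

(** A short step that changes the half-plane starts close to the x-axis, so its distance to the
    origin must come from the first coordinate. *)
Lemma upper_change (e : R) z z' : 0 < e -> ~~ near_pt (2 * e) z 0 ->
  near_pt e z z' -> upper z != upper z' -> 2 * e <= `|z.1|.
Proof.
case: z z' => [z1 z2] [w1 w2] e0; rewrite /near_pt /upper /= !subr0 => far.
case/andP=> _ /ltr_normlP[h1 h2] ch.
have : ~~ (`|z2| < 2 * e) || (2 * e <= `|z1|) by rewrite leNgt -negb_and andbC.
case/orP => //; rewrite -leNgt ler_normr => hz.
move: ch; have [k|k|k] := ltgtP 0 z2; have [k'|k'|k'] := ltgtP 0 w2 => //=;
  case/orP: hz => hz; lra.
Qed.

(** Each change of half-plane crosses one of the two halves of the x-axis, and negation exchanges
    these halves. *)
Lemma cross_opp (e : R) z z' : 0 < e -> ~~ near_pt (2 * e) z 0 ->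
  near_pt e z z' -> upper (- z) = ~~ upper z -> upper (- z') = ~~ upper z' ->
  cross (- z) (- z') = cross z z' (+) (upper z (+) upper z').
Proof.
move=> e0 far nr hz hz'; rewrite /cross hz hz'.
have [->|ne] := eqVneq (upper z) (upper z'); first by rewrite !addbb.
have := upper_change e0 far nr ne; rewrite ler_normr /= => hh.
have -> : (~~ upper z (+) ~~ upper z') = true by case: (upper z) (upper z') ne => [] [].
have -> : (upper z (+) upper z') = true by case: (upper z) (upper z') ne => [] [].
by rewrite /= oppr_lt0; have [k|k|k] := ltgtP z.1 0 => //; lra.
Qed.

(** If a side of the square [u - a], [v - a], [v - b], [u - b] changes half-plane, all four corners
    lie on the same side of the y-axis. So either all half-plane changes are crossings or none is,
    and a closed walk has an even number of changes. *)
Lemma cross_square (e : R) u v a b : 0 < e ->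
  near_pt e u v -> near_pt e a b ->
  (forall p q, p \in [:: u; v] -> q \in [:: a; b] -> ~~ near_pt (2 * e) p q) ->
  cross (u - a) (v - a) (+) cross (u - b) (v - b) =
  cross (u - a) (u - b) (+) cross (v - a) (v - b).
Proof.
move=> e0 nuv nab far.
have F p q : p \in [:: u; v] -> q \in [:: a; b] -> ~~ near_pt (2 * e) (p - q) 0.
  by move=> hp hq; have := far _ _ hp hq; rewrite /near_pt /= !subr0.
have N1 p q w : near_pt e p q -> near_pt e (p - w) (q - w).
  rewrite /near_pt; have -> : (p - w).1 - (q - w).1 = p.1 - q.1 by rewrite /=; lra.
  by have -> : (p - w).2 - (q - w).2 = p.2 - q.2 by rewrite /=; lra.
have N2 p q w : near_pt e p q -> near_pt e (w - p) (w - q).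
  rewrite /near_pt distrC [`|p.2 - _|]distrC.
  have -> : (w - p).1 - (w - q).1 = q.1 - p.1 by rewrite /=; lra.
  by have -> : (w - p).2 - (w - q).2 = q.2 - p.2 by rewrite /=; lra.
have sg (x y : R) : 2 * e <= `|x| -> `|x - y| < 2 * e -> (x < 0) = (y < 0).
  rewrite ler_normr => h /ltr_normlP[h1 h2].
  have [k|k|k] := ltgtP x 0; have [k'|k'|k'] := ltgtP y 0 => //; lra.
have [uI vI aI bI] : [/\ u \in [:: u; v], v \in [:: u; v], a \in [:: a; b] & b \in [:: a; b]].
  by rewrite !inE !eqxx !orbT.
case/andP: (nuv) => duv _; case/andP: (nab) => dab _.
have D1 (x y p p' : R * R) : `|x.1 - y.1| < e -> p \in [:: x; y] -> p' \in [:: x; y] ->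
    `|p.1 - p'.1| < e.
  move=> dxy; rewrite !inE => /orP[]/eqP-> /orP[]/eqP->; rewrite ?subrr ?normr0 //.
  by rewrite distrC.
have D p q p' q' : p \in [:: u; v] -> q \in [:: a; b] ->
    p' \in [:: u; v] -> q' \in [:: a; b] -> `|(p - q).1 - (p' - q').1| < 2 * e.
  move=> hp hq hp' hq'.
  have -> : (p - q).1 - (p' - q').1 = (p.1 - p'.1) - (q.1 - q'.1) by rewrite /=; ring.
  rewrite (_ : 2 * e = e + e); last by ring.
  by apply: le_lt_trans (ler_normB _ _) (ltrD (D1 _ _ _ _ duv hp hp') (D1 _ _ _ _ dab hq hq')).
have key p q p' q' : p \in [:: u; v] -> q \in [:: a; b] ->
    2 * e <= `|(p - q).1| -> p' \in [:: u; v] -> q' \in [:: a; b] ->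
   ((p - q).1 < 0) = ((p' - q').1 < 0).
  by move=> *; apply: sg => //; apply: D.
have [E1|E1] := eqVneq (upper (u - a)) (upper (v - a)); last first.
  have K := upper_change e0 (F _ _ uI aI) (N1 _ _ _ nuv) E1.
  rewrite /cross -!(key _ _ _ _ uI aI K) //.
  case: (_ < 0); rewrite ?andbF // !andbT.
  by move: (upper _) (upper _) (upper _) (upper _) => [] [] [] [].
have [E2|E2] := eqVneq (upper (u - b)) (upper (v - b)); last first.
  have K := upper_change e0 (F _ _ uI bI) (N1 _ _ _ nuv) E2.
  rewrite /cross -!(key _ _ _ _ uI bI K) //.
  case: (_ < 0); rewrite ?andbF // !andbT.
  by move: (upper _) (upper _) (upper _) (upper _) => [] [] [] [].
have [E3|E3] := eqVneq (upper (u - a)) (upper (u - b)); last first.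
  have K := upper_change e0 (F _ _ uI aI) (N2 _ _ _ nab) E3.
  rewrite /cross -!(key _ _ _ _ uI aI K) //.
  case: (_ < 0); rewrite ?andbF // !andbT.
  by move: (upper _) (upper _) (upper _) (upper _) => [] [] [] [].
by rewrite /cross -E1 -E2 -E3 !addbb.
Qed.

Definition apart (e : R) s r :=
  forall p q, p \in s -> q \in r -> ~~ near_pt (2 * e) p q.

Lemma cross_strip (e : R) u v a r : 0 < e -> near_pt e u v ->
  path (near_pt e) a r -> apart e [:: u; v] (a :: r) ->
  cross (u - a) (v - a) (+) cross (u - last a r) (v - last a r) =
  wind (u - a) [seq u - q | q <- r] (+) wind (v - a) [seq v - q | q <- r].
Proof.
move=> e0 nuv; elim: r a => [|b r IH] a /=; first by rewrite addbb.
case/andP=> nab pr far.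
have /(cross_square e0 nuv nab) sq : apart e [:: u; v] [:: a; b].
  by move=> p q hp; rewrite !inE => hq; apply: far; rewrite // !inE orbA hq.
have /(IH b pr) IHb : apart e [:: u; v] (b :: r).
  by move=> p q hp hq; apply: far; rewrite // inE hq orbT.
move: sq IHb; move: (cross (u - a) _) (cross (u - b) (v - b)) => c1 c2.
move: (cross (u - a) _) (cross (v - a) _) (cross (u - last b r) _) => c3 c4 c5.
by move: (wind _ _) (wind _ _); case: c1 c2 c3 c4 c5 => [] [] [] [] [] [] [].
Qed.

(** The differences form a grid of squares; when [cross_strip] is summed over its strips, inner
    sides cancel and the boundary remains. *)
Lemma wind_grid (e : R) u s a r : 0 < e ->
  path (near_pt e) u s -> path (near_pt e) a r -> apart e (u :: s) (a :: r) ->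
  wind (u - a) [seq p - a | p <- s] (+)
    wind (u - last a r) [seq p - last a r | p <- s] =
  wind (u - a) [seq u - q | q <- r] (+)
    wind (last u s - a) [seq last u s - q | q <- r].
Proof.
move=> e0 + pr; elim: s u => [|v s IH] u /=; first by rewrite addbb.
case/andP=> nuv ps far.
have /(cross_strip e0 nuv pr) st : apart e [:: u; v] (a :: r).
  by move=> p q hp; apply: far; move: hp; rewrite !inE orbA => ->.
have /(IH v ps) IHv : apart e (v :: s) (a :: r).
  by move=> p q hp; apply: far; rewrite // inE hp orbT.
move: st IHv; move: (cross _ _) (cross _ _) => c1 c2.
by move: (wind _ _) (wind _ _) (wind _ _) (wind _ _) (wind _ _);
  case: c1 c2 => [] [] [] [] [] [] [].
Qed.

(** In the sum of [cross_opp] along [r] the half-plane changes telescope. *)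
Lemma wind_opp (e : R) u a r : 0 < e ->
  path (near_pt e) a r -> apart e [:: u] (a :: r) ->
  wind (u - a) [seq u - q | q <- r] =
  wind (a - u) [seq q - u | q <- r] (+) (upper (u - a) (+) upper (u - last a r)).
Proof.
move=> e0; elim: r a => [|b r IH] a /=; first by rewrite addbb.
case/andP=> nab pr far.
have e20 : 0 < 2 * e by lra.
have fa : ~~ near_pt (2 * e) u a by apply: far; rewrite !inE eqxx.
have fb : ~~ near_pt (2 * e) u b by apply: far; rewrite !inE eqxx ?orbT.
rewrite IH //; last first.
  by move=> p q hp hq; apply: far; rewrite // inE hq orbT.
have -> : cross (a - u) (b - u) =
    cross (u - a) (u - b) (+) (upper (u - a) (+) upper (u - b)).
  rewrite -[a - u]opprB -[b - u]opprB; apply: (cross_opp e0) => //.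
  - by move: fa; rewrite /near_pt /= !subr0.
  - move: nab; rewrite /near_pt distrC [`|a.2 - _|]distrC.
    have -> : (u - a).1 - (u - b).1 = b.1 - a.1 by rewrite /=; lra.
    by have -> : (u - a).2 - (u - b).2 = b.2 - a.2 by rewrite /=; lra.
  - by rewrite opprB; apply: upperN e20 _.
  - by rewrite opprB; apply: upperN e20 _.
by move: (cross _ _) (wind _ _) (upper _) (upper _) (upper _) => [] [] [] [] [].
Qed.

End Winding.

(** * Drawings up to scale, and K5 *)

Section Drawing.
Local Open Scope ring_scope.
Variable R : realType.

(* A drawing up to scale [e]: edges are chains of points with steps below [e],
   and chains of edges without common endpoint stay [2 * e] apart; nothing is
   required of edges that share an endpoint. *)
Definition drawing (T : finType) (g : rel T) : Prop :=
  exists (e : R) (pos : T -> R * R) (ch : T -> T -> seq (R * R)),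
  [/\ 0 < e,
      forall u v, g u v ->
        path (near_pt e) (pos u) (ch u v) /\ last (pos u) (ch u v) = pos v
    & forall u v a b, g u v -> g a b -> uniq [:: u; v; a; b] ->
        apart e (pos u :: ch u v) (pos a :: ch a b)].

(** [n a u v] is the winding of the chain of [uv] around [a], and [o] is the lexicographic order.
    Its antisymmetry needs [a] and [b] at separate positions, which disjoint edges at them
    provide. *)
Lemma drawing_parity (T : finType) (g : rel T) : drawing g ->
  exists (n : T -> T -> T -> bool) (o : rel T),
  (forall a b, a != b -> (exists c d, [/\ g a c, g b d & uniq [:: a; c; b; d]]) ->
     o b a = ~~ o a b) /\
  (forall u v a b, g u v -> g a b -> uniq [:: u; v; a; b] ->
     n a u v (+) n b u v (+) (n u a b (+) n v a b) =
     o u a (+) o u b (+) (o v a (+) o v b)).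
Proof.
case=> e [pos] [ch] [e0 chP apP].
exists (fun a u v => wind (pos u - pos a) [seq p - pos a | p <- ch u v]).
exists (fun u a => upper (pos u - pos a)); split.
  move=> a b ab [c] [d] [gac gbd dj]; apply: (@upperN _ _ _ (2 * e)); first lra.
  by apply: (apP _ _ _ _ gac gbd dj); rewrite inE eqxx.
move=> u v a b guv gab dj.
have [puv luv] := chP _ _ guv; have [pab lab] := chP _ _ gab.
have ap := apP _ _ _ _ guv gab dj.
have := wind_grid e0 puv pab ap; rewrite luv lab => ->.
have vI : pos v \in pos u :: ch u v by rewrite -luv mem_last.
have /(wind_opp e0 pab)-> : apart e [:: pos u] (pos a :: ch a b).
  by move=> p q; rewrite inE => /eqP->; apply: ap; rewrite inE eqxx.
have /(wind_opp e0 pab)-> : apart e [:: pos v] (pos a :: ch a b).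
  by move=> p q; rewrite inE => /eqP->; apply: ap.
rewrite lab; move: (upper _) (upper _) (upper _) (upper _) (wind _ _) (wind _ _).
by do 6![case].
Qed.

Lemma drawing_no_K5 (T : finType) (g : rel T) (K : {set T}) :
  drawing g -> #|K| = 5%N -> {in K &, forall u v, u != v -> g u v} -> False.
Proof.
case/drawing_parity=> n [o] [oN nP] K5 gK.
have /card_gt0P[x0 _] : (0 < #|K|)%N by rewrite K5.
pose x i := nth x0 (enum K) i.
have xK i : (i < 5)%N -> x i \in K.
  by move=> i5; rewrite -mem_enum mem_nth // -cardE K5.
have xI i j : (i < 5)%N -> (j < 5)%N -> (x i == x j) = (i == j).
  by move=> i5 j5; rewrite nth_uniq ?enum_uniq // -cardE K5.
have gx i j : (i < 5)%N -> (j < 5)%N -> i != j -> g (x i) (x j).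
  by move=> i5 j5 ij; apply: gK; rewrite ?xK // xI.
have ux i j k l : (i < 5)%N -> (j < 5)%N -> (k < 5)%N -> (l < 5)%N ->
    uniq [:: i; j; k; l] -> uniq [:: x i; x j; x k; x l].
  by move=> i5 j5 k5 l5; rewrite /= !inE !xI.
have addbE b1 b2 : b1 (+) b2 = xorb b1 b2 by case: b1 b2 => [] [].
pose N a b c := n (x a) (x b) (x c); pose O a b := o (x a) (x b).
have ON i j : (i < 5)%N -> (j < 5)%N -> i != j -> O j i = negb (O i j).
  move=> i5 j5 ij; apply: oN; rewrite ?xI //.
  have [k [l [k5 l5 u4]]] : exists k l, [/\ (k < 5)%N, (l < 5)%N & uniq [:: i; k; j; l]].
    case: i j i5 j5 ij => [|[|[|[|[|i]]]]] [|[|[|[|[|j]]]]] // _ _ _;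
      by first [by exists 0%N, 1%N | by exists 0%N, 2%N | by exists 0%N, 3%N
        | by exists 1%N, 2%N | by exists 1%N, 3%N | by exists 2%N, 3%N
        | by exists 2%N, 4%N | by exists 3%N, 4%N].
  exists (x k), (x l); rewrite ux //; move: u4.
  rewrite /= !inE !negb_or => /and4P[/and3P[ik _ _] _ jl _].
  by split => //; apply: gx.
pose L q := if q is [:: i; j; k; l] then
  xorb (xorb (N k i j) (N l i j)) (xorb (N i k l) (N j k l)) else false.
pose M q := if q is [:: i; j; k; l] then
  xorb (xorb (O i k) (O i l)) (xorb (O j k) (O j l)) else false.
(* The list [i, j, k, l] stands for the disjoint edges [ij] and [kl]. *)
pose qs : seq (seq nat) := ([::
  [:: 0; 1; 2; 3]; [:: 0; 1; 2; 4]; [:: 0; 1; 3; 4]; [:: 0; 2; 1; 3];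
  [:: 0; 2; 1; 4]; [:: 0; 2; 3; 4]; [:: 0; 3; 1; 2]; [:: 0; 3; 1; 4];
  [:: 0; 3; 2; 4]; [:: 0; 4; 1; 2]; [:: 0; 4; 1; 3]; [:: 0; 4; 2; 3];
  [:: 1; 2; 3; 4]; [:: 1; 3; 2; 4]; [:: 1; 4; 2; 3]])%N.
have LM q : all (fun i => (i < 5)%N) q -> uniq q -> L q = M q.
  case: q => [|i [|j [|k [|l [|? ?]]]]] // /and5P[i5 j5 k5 l5 _] u4.
  have u4x := ux _ _ _ _ i5 j5 k5 l5 u4.
  move: u4; rewrite /= !inE !negb_or => /and4P[/and3P[ij _ _] _ kl _].
  by rewrite -!addbE; apply: nP; rewrite ?gx.
have : [seq L q | q <- qs] = [seq M q | q <- qs].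
  apply/eq_in_map => q qsP.
  have /allP/(_ q qsP)/andP[q5 uq] :
    all (fun q => all (fun i => (i < 5)%N) q && uniq q) qs by [].
  exact: LM.
move/(congr1 (foldr xorb false)).
(* Each [N k i j] occurs twice, once for each edge at [k] disjoint from [ij]. *)
have -> : foldr xorb false [seq L q | q <- qs] = false by rewrite /= /L; btauto.
(* Each pair of vertices is compared in six of the 15 terms, so only the reversed comparisons
   matter: none for separated, one for interleaving and two for nested edges. *)
have -> : foldr xorb false [seq M q | q <- qs] = true.
  rewrite /= /M (ON 1%N 2%N) // (ON 1%N 3%N) // (ON 1%N 4%N) //.
  rewrite (ON 2%N 3%N) // (ON 2%N 4%N) // (ON 3%N 4%N) //.
  by btauto.
by [].
Qed.
End Drawing.

(** * Density of drawn graphs *)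

Section Mader.
(* Restores the finite-set lemmas shadowed by classical_sets. *)
Import mathcomp.boot.fintype mathcomp.boot.finset.
Variable T : finType.
Implicit Types (S K : {set T}) (g : rel T) (u v w a b : T).
Local Open Scope set_scope.

Definition contract u v g : rel T :=
  fun a b => (a != b) && [|| g a b, (a == u) && g v b | (b == u) && g a v].
Arguments contract u v g a b /.

(** A graph is a relation read on a vertex set. The first clause covers subgraphs and makes [Q]
    independent of [g] outside [S]. *)
Definition minor_closed (Q : {set T} -> rel T -> Prop) : Prop :=
  (forall S S' g g', S' \subset S ->
     {in S' &, forall a b, g' a b -> g a b} -> Q S g -> Q S' g') /\
  (forall S g u v, symmetric g -> u \in S -> v \in S -> u != v -> g u v ->
     Q S g -> Q (S :\ v) (contract u v g)).

Definition clique (t : nat) S g : Prop :=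
  exists K, [/\ K \subset S, #|K| = t & {in K &, forall u v, u != v -> g u v}].

Definition nbrs S g u := [set v in S | g u v].

Definition degree_sum S g := \sum_(u in S) #|nbrs S g u|.

Lemma contract_sym u v g : symmetric g -> symmetric (contract u v g).
Proof.
move=> sg a b; rewrite /contract /= eq_sym (sg a) (sg v) (sg a v).
by congr (_ && (_ || _)); rewrite orbC.
Qed.

(** Contraction loses the edge [uv] and merges two edges at every common neighbour; each loss counts
    twice in the degree sum. *)
Lemma degree_sum_contract S g u v : symmetric g -> irreflexive g ->
  u \in S -> v \in S -> g u v ->
  degree_sum S g <= degree_sum (S :\ v) (contract u v g) +
    2 * (1 + #|nbrs S g u :&: nbrs S g v|).
Proof.
move=> sg ig uS vS guv.
have uv : u != v by apply: contraTneq guv => ->; rewrite ig.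
set C := _ :&: _.
have uSv : u \in S :\ v by rewrite !inE uv.
rewrite /degree_sum (big_setD1 v vS) (big_setD1 u uSv) /=.
rewrite [X in _ <= X + _](big_setD1 u uSv) /=.
have du : #|nbrs S g v| + #|nbrs S g u| <=
    #|nbrs (S :\ v) (contract u v g) u| + (2 + #|C|).
  have -> : #|nbrs S g v| + #|nbrs S g u| =
      #|nbrs S g u :|: nbrs S g v| + #|C| by rewrite addnC -cardsUI.
  rewrite addnA leq_add2r.
  apply: leq_trans (_ : #|u |: (v |: nbrs (S :\ v) (contract u v g) u)| <= _).
    apply: subset_leq_card; apply/subsetP=> a; rewrite !inE /= ?eqxx /=.
    have [->//|au] := eqVneq a u; have [->//|av] := eqVneq a v.
    by case: (a \in S) => //= /orP[->|->]; rewrite ?orbT.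
  by rewrite !cardsU1 addnA addnC leq_add2l; do 2!case: (_ \notin _).
have da a : a \in S :\ v :\ u ->
    #|nbrs S g a| <= #|nbrs (S :\ v) (contract u v g) a| + (a \in C).
  move=> aD; have /and3P[au av aS] : [&& a != u, a != v & a \in S].
    by move: aD; rewrite !inE.
  have [gav|gav] := boolP (g a v); last first.
    rewrite -[#|nbrs S g a|]addn0 leq_add //; apply: subset_leq_card.
    apply/subsetP=> b; rewrite !inE => /andP[bS gab]; rewrite bS /= gab /=.
    have -> /= : b != v by apply: contraNneq gav => <-.
    by rewrite andbT; apply: contraTneq gab => ->; rewrite ig.
  have aC : (a \in C) = g a u by rewrite !inE aS /= sg (sg v) gav andbT.
  rewrite (cardsD1 v) inE vS gav /=.
  set N' := nbrs (S :\ v) _ a.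
  have uN : u \in N' by rewrite inE uSv /= au eqxx gav !orbT.
  rewrite (cardsD1 u N') uN -addnA leq_add2l.
  rewrite (cardsD1 u (_ :\ v)) addnC leq_add //; last first.
    by rewrite aC !inE uv uS.
  apply: subset_leq_card; apply/subsetP=> b; rewrite !inE.
  case/and4P=> bu bv bS gab; rewrite bu bv bS /= gab andbT.
  by apply: contraTneq gab => ->; rewrite ig.
have ds : \sum_(a in S :\ v :\ u) #|nbrs S g a| <=
   \sum_(a in S :\ v :\ u) #|nbrs (S :\ v) (contract u v g) a| + #|C|.
  have /leq_trans-> // : \sum_(a in S :\ v :\ u) #|nbrs S g a| <=
      \sum_(a in S :\ v :\ u)
        (#|nbrs (S :\ v) (contract u v g) a| + (a \in C)) by exact: leq_sum.
  rewrite big_split leq_add2l /=.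
  rewrite -[X in _ <= X]sum1_card big_mkcond [X in _ <= X]big_mkcond /=.
  by apply: leq_sum => a _; case: (a \in C); case: ifP.
move: du ds; set x1 := #|_|; set x2 := #|_|; set x3 := #|_|; set x4 := #|_|.
set y1 := bigop _ _ _; set y2 := bigop _ _ _; lia.
Qed.

Fixpoint mader_const t := if t is t'.+1 then 2 * (1 + mader_const t') else 0.

(* If every edge lies in more than [mader_const t] triangles, then a
   neighbourhood is dense, and by induction it contains a [K_t] minor, hence
   the graph a [K_(t+1)] minor; otherwise contracting an edge that lies in few
   triangles does not decrease the density. *)
Theorem mader t (Q : {set T} -> rel T -> Prop) : minor_closed Q ->
  (forall S g, Q S g -> ~ clique t S g) ->
  forall S g, symmetric g -> irreflexive g -> Q S g ->
  degree_sum S g <= mader_const t * #|S|.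
Proof.
elim: t Q => [|t IHt] Q [Qsub Qcon] QK S g sg ig QS.
  case: (QK _ _ QS); exists set0; split; rewrite ?sub0set ?cards0 //.
  by move=> u v; rewrite inE.
have [n] := ubnP #|S|; elim: n S g sg ig QS => // n IHn S g sg ig QS.
rewrite ltnS => Sn.
have [|nolight] := boolP [exists u in S, exists v in S,
    g u v && (#|nbrs S g u :&: nbrs S g v| <= mader_const t)].
  case/'exists_in_existsP => u uS [v] /and3P[vS guv few].
  have uv : u != v by apply: contraTneq guv => ->; rewrite ig.
  have := degree_sum_contract sg ig uS vS guv.
  have Sv := cardsD1 v S; rewrite vS in Sv.
  have ic : irreflexive (contract u v g) by move=> a; rewrite /= eqxx.
  have /(IHn _ _ (contract_sym _ _ sg) ic) H1 := Qcon _ _ _ _ sg uS vS uv guv QS.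
  have {H1} H1 := H1 ltac:(lia).
  rewrite Sv => H2; rewrite mulnDr muln1 addnC.
  apply: leq_trans H2 _; apply: leq_add => //=.
  by rewrite leq_mul2l leq_add2l.
have [->|[w wS]] := set_0Vmem S; first by rewrite /degree_sum big_set0.
have [iso|] := boolP [forall u in S, nbrs S g u == set0].
  rewrite /degree_sum big1 // => u uS; move/forall_inP/(_ u uS)/eqP: iso => ->.
  by rewrite cards0.
case/forall_inPn=> u uS /set0Pn[v vN].
(* [Q'] asks [Q] for the cone over [S] with a new apex [w]. It excludes [K_t], because the apex
   would complete it to [K_(t+1)]; the neighbourhood of [u] has it with apex [u]. *)
pose Q' S g := exists2 w, w \notin S & 
  Q (w |: S) [rel a b | if a == w then b != w else (b == w) || g a b].
have Q'S : Q' (nbrs S g u) g.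
  exists u; first by rewrite inE ig andbF.
  apply: (Qsub _ _ _ _ _ _ QS).
    by apply/subsetP=> a; rewrite !inE => /orP[/eqP->//|/andP[]].
  move=> a b; rewrite !inE /=.
  have [->|au] /= := eqVneq a u.
    by have [->|bu] //= := eqVneq b u => _ /andP[_ ->].
  by have [->|bu] //= := eqVneq b u => /andP[_]; rewrite sg.
(* Every edge [ua] lies in more than [mader_const t] triangles, so [a] has more than that many
   neighbours inside the neighbourhood of [u]. *)
have dense : mader_const t * #|nbrs S g u| < degree_sum (nbrs S g u) g.
  have : \sum_(a in nbrs S g u) (mader_const t).+1 <= degree_sum (nbrs S g u) g.
    apply: leq_sum => a; rewrite inE => /andP[aS gua].
    move: nolight; rewrite negb_exists_in => /forall_inP/(_ u uS).
    rewrite negb_exists_in => /forall_inP/(_ a aS); rewrite gua /= -ltnNge.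
    move/leq_trans; apply; apply: subset_leq_card; apply/subsetP=> b.
    by rewrite !inE => /andP[/andP[-> ->]] /andP[_ ->].
  rewrite sum_nat_const mulnC; apply: leq_trans.
  by rewrite mulSn -[X in X < _]add0n ltn_add2r; apply/card_gt0P; exists v.
suff : degree_sum (nbrs S g u) g <= mader_const t * #|nbrs S g u|.
  by rewrite leqNgt dense.
apply: (IHt Q') => //.
- split.
  + move=> S1 S2 g1 g2 S21 g21 [x xS Qx].
    exists x; first by apply: contra xS => /(subsetP S21).
    apply: (Qsub _ _ _ _ _ _ Qx); first by rewrite setUS.
    move=> a b; rewrite !inE /=.
    have [//|ax] /= := eqVneq a x; have [//|bx] /= := eqVneq b x.
    exact: g21.
  + move=> S1 g1 a b sg1 aS bS ab gab [x xS Qx].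
    have xa : x != a by apply: contraNneq xS => ->.
    have xb : x != b by apply: contraNneq xS => ->.
    exists x; first by rewrite !inE negb_and xS orbT.
    have sc : symmetric [rel a b | if a == x then b != x else (b == x) || g1 a b].
      by move=> c d /=; rewrite sg1; case: eqVneq; case: eqVneq.
    (* Contracting an edge of the base commutes with taking the cone. *)
    have := Qcon _ _ a b sc _ _ ab _ Qx; rewrite !inE aS bS !orbT /=.
    rewrite ![_ == x]eq_sym (negPf xa) (negPf xb) gab => /(_ isT isT isT) Qc.
    apply: (Qsub _ _ _ _ _ _ Qc).
      by apply/subsetP=> c; rewrite !inE => /orP[/eqP->|/andP[-> ->]]; rewrite ?xb ?eqxx ?orbT.
    move=> c d _ _ /=; rewrite ![_ == x]eq_sym.
    have [xc|xc] := eqVneq x c; have [xd|xd] := eqVneq x d; rewrite -?xc -?xd ?eqxx //=.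
    * by rewrite xd.
    * by rewrite [c == x]eq_sym xc.
    * rewrite (negPf xb) => /andP[-> /or3P[->//|/andP[-> ->]|/andP[-> ->]]] /=;
      by rewrite !orbT.
- move=> S1 g1 [x xS Qx] [K [KS Kt gK]]; apply: (QK _ _ Qx).
  have xK : x \notin K by apply: contra xS => /(subsetP KS).
  exists (x |: K); rewrite setUS // cardsU1 xK Kt; split=> //.
  move=> a b; rewrite !inE /=.
  have [->|ax] /= := eqVneq a x; first by rewrite eq_sym.
  have [->|bx] //= := eqVneq b x.
  exact: gK.
Qed.

End Mader.

(** * Contraction of drawings, and light edges in the absence of 4-cycles *)

Section Density.
Import mathcomp.boot.fintype mathcomp.boot.finset.
Local Open Scope set_scope.
Variables (R : realType) (T : finType).
Implicit Types (S : {set T}) (g h : rel T) (u v a b : T).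

Fixpoint walk_chain (ch : T -> T -> seq (R * R)) u (p : seq T) :=
  if p is v :: p' then ch u v ++ walk_chain ch v p' else [::].

(** Edges of [h] are drawn by concatenating the chains along walks in [g]. Edges on two
    vertex-disjoint walks have no common endpoint, so their chains are apart. *)
Lemma drawing_walks g h (p : T -> T -> seq T) : irreflexive g ->
  (forall u v, h u v -> path g u (p u v) /\ last u (p u v) = v) ->
  (forall u v a b, h u v -> h a b -> uniq [:: u; v; a; b] ->
     ~~ has [in u :: p u v] (a :: p a b)) ->
  drawing R g -> drawing R h.
Proof.
move=> ig pP pD [e [pos [ch [e0 chP chD]]]].
exists e, pos, (fun u v => walk_chain ch u (p u v)); split=> //.
  move=> u v /pP[]; move: (p u v) => s; elim: s u => [|w s IHs] u /=; first by move=> _ ->.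
  case/andP=> /chP[p1 l1] p2 l2; have [p3 l3] := IHs w p2 l2.
  by rewrite cat_path last_cat l1 p1 p3.
(* Every point is charged to an edge of the walk; an empty walk has a start but no edge. *)
have mem_chain u s q : path g u s -> s != [::] -> q \in pos u :: walk_chain ch u s ->
    exists x y, [/\ g x y, x \in u :: s, y \in u :: s & q \in pos x :: ch x y].
  elim: s u => // w s IHs u /= /andP[guw ps] _.
  rewrite inE mem_cat => /or3P[/eqP->|qc|qc].
  - by exists u, w; rewrite guw !inE !eqxx ?orbT.
  - by exists u, w; rewrite guw !inE !eqxx ?orbT qc ?orbT.
  - have [s0|s0] := eqVneq s [::]; first by rewrite s0 in qc.
    have [|x [y [gxy xs ys qx]]] := IHs w ps s0; first by rewrite inE qc orbT.
    by exists x, y; split=> //; rewrite inE ?xs ?ys orbT.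
move=> u v a b huv hab uq x y xu ya.
have nonnil c d : h c d -> c != d -> p c d != [::].
  by case/pP=> _ l cd; apply: contraNneq cd => pn; rewrite -l pn.
have [x1 [x2 [gx x1u x2u xx]]] := mem_chain _ _ _ (pP _ _ huv).1 (nonnil _ _ huv
  ltac:(by move: uq => /= /andP[]; rewrite inE negb_or => /andP[])) xu.
have [y1 [y2 [gy y1a y2a yy]]] := mem_chain _ _ _ (pP _ _ hab).1 (nonnil _ _ hab
  ltac:(by move: uq => /= /and4P[_ _]; rewrite inE)) ya.
apply: (chD _ _ _ _ gx gy _ x y xx yy).
have /hasPn dj := pD _ _ _ _ huv hab uq.
have ne z t : z \in u :: p u v -> t \in a :: p a b -> z != t.
  by move=> zu /dj; apply: contraNneq => <-.
have nl z t : g z t -> z != t by move=> gzt; apply: contraTneq gzt => ->; rewrite ig.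
by rewrite /= !inE !negb_or (nl _ _ gx) (nl _ _ gy) !ne.
Qed.

Lemma drawing_sub g h : subrel h g -> drawing R g -> drawing R h.
Proof.
move=> hg [e [pos [ch [e0 chP chD]]]]; exists e, pos, ch; split=> //.
- by move=> u v /hg/chP.
- by move=> u v a b /hg guv /hg gab; apply: chD.
Qed.

Definition restrict S g : rel T := fun a b => [&& a \in S, b \in S & g a b].
Arguments restrict S g a b /.

Lemma drawing_minor_closed :
  minor_closed (fun S g => drawing R (restrict S [rel a b | (a != b) && g a b])).
Proof.
split=> [S S' g g' SS' g'g|S g u v sg uS vS uv guv].
  apply: drawing_sub => a b /= /and4P[aS bS ab gab].
  by rewrite !(subsetP SS') // ab g'g.
pose k := restrict S [rel a b | (a != b) && g a b].
(* An edge created by the contraction ends in [u] and is routed through [v]; two such edges share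
   [u], hence are never disjoint. *)
apply: (@drawing_walks k _ (fun a b => if g a b then [:: b] else [:: v; b])).
- by move=> a; rewrite /k /= eqxx !andbF.
- move=> a b /=; rewrite !inE => /and4P[/andP[av aS] /andP[bv bS] ab].
  case/andP=> _; rewrite /k; case: (boolP (g a b)) => [gab _|gab /=].
    by rewrite /= aS bS ab gab.
  rewrite aS bS vS av (eq_sym v) bv /= => /orP[] /andP[/eqP-> ->].
    by rewrite guv.
  by rewrite sg guv.
- move=> a b c d /=; rewrite !inE => /and4P[/andP[av aS] /andP[bv bS] ab /andP[_ gab]].
  move=> /and4P[/andP[cv cS] /andP[dv dS] cd /andP[_ gcd]].
  case/and4P=> /norP[_ /norP[ac ad]] /norP[bc bd] _ _.
  case: (boolP (g a b)) gab => [_ _|gab /= gab'];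
    case: (boolP (g c d)) gcd => [_ _|gcd /= gcd'];
    rewrite /= !inE ?(eq_sym c a) ?(eq_sym c b) ?(eq_sym d a) ?(eq_sym d b)
      ?(negPf ac) ?(negPf ad) ?(negPf bc) ?(negPf bd) //= ?[v == _]eq_sym
      ?(negPf av) ?(negPf bv) ?(negPf cv) ?(negPf dv) //=.
  have : (u \in [:: a; b]) && (u \in [:: c; d]).
    rewrite !inE !(eq_sym u); apply/andP; split.
      by case/orP: gab' => /andP[-> _]; rewrite ?orbT.
    by case/orP: gcd' => /andP[-> _]; rewrite ?orbT.
  rewrite !inE => /andP[/orP[] /eqP->]; first by rewrite (negPf ac) (negPf ad).
  by rewrite (negPf bc) (negPf bd).
Qed.

Definition density := mader_const 5.

Lemma drawing_density S g : symmetric g -> irreflexive g ->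
  drawing R (restrict S g) -> degree_sum S g <= density * #|S|.
Proof.
move=> sg ig dr; apply: (mader drawing_minor_closed) => //.
  move=> S1 g1 dr1 [K [KS K5 gK]]; apply: (drawing_no_K5 dr1 K5) => u v uK vK uv.
  by rewrite /= !(subsetP KS) // uv gK.
by apply: drawing_sub dr => a b /= /and4P[-> -> _ ->].
Qed.

Definition c4_free g := forall u v x y, u != v -> x != y ->
  g u x -> g u y -> g v x -> ~~ g v y.

(** Calibrated for the count in [light_edge]: if [A] has at most [density] times the size of [B],
    degrees above [light] in [B] sum to more than [density] times the size of [A :|: B]. *)
Definition light := density * (density + 1).

(* A vertex of degree between 2 and [light] joins two vertices of large degree
   by a path of length 2; without 4-cycles these pairs are distinct, so the
   paths form a drawn graph on the vertices of large degree. Hence the latter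
   are a positive fraction of all vertices, too many for the density of [g]. *)
Lemma light_edge g : symmetric g -> irreflexive g -> c4_free g -> drawing R g ->
  (forall u, #|[set v | g u v]| != 1) -> (exists u v, g u v) ->
  exists u v, [/\ g u v, #|[set w | g u w]| <= light & #|[set w | g v w]| <= light].
Proof.
move=> sg ig c4 dr deg1 [u0 [v0 g0]].
pose deg u := #|[set v | g u v]|.
have [|nolight] := boolP [exists u, exists v, [&& g u v, deg u <= light & deg v <= light]].
  by case/existsP=> u /existsP[v /and3P[]]; exists u, v.
have {nolight} nl u v : g u v -> deg u <= light -> light < deg v.
  move=> guv du; rewrite ltnNge; apply: contra nolight => dv.
  by apply/existsP; exists u; apply/existsP; exists v; rewrite guv du.
exfalso.
pose B := [set u | light < deg u]; pose A := [set u | 0 < deg u <= light].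
have deg_gt0 u v : g u v -> 0 < deg u by move=> guv; apply/card_gt0P; exists v; rewrite inE.
(* A vertex of [A] has at least two neighbours, all of them in [B]; [(a, a)] is a default outside
   [A]. *)
have pick a : exists p : T * T, a \in A ->
    [/\ g a p.1, g a p.2, p.1 != p.2, p.1 \in B & p.2 \in B].
  case: (boolP (a \in A)) => [aA|_]; last by exists (a, a).
  have /andP[d0 dl] : 0 < deg a <= light by rewrite inE in aA.
  have /card_gt1P[x [y [xa ya xy]]] : 1 < #|[set v | g a v]|.
    by rewrite ltn_neqAle eq_sym deg1.
  rewrite !inE in xa ya; exists (x, y) => _ /=; rewrite !inE.
  by split=> //; apply: nl dl.
have [p pP] := choice pick.
have B0 : 0 < #|B|.
  apply/card_gt0P; have [du|du] := leqP (deg u0) light; last by exists u0; rewrite inE.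
  by exists v0; rewrite inE (nl _ _ g0).
have AB a b : a \in A -> b \in B -> a != b.
  by rewrite !inE => /andP[_ da] db; apply: contraTneq db => <-; rewrite -leqNgt.
pose h : rel T := [rel b c | [exists a in A, (p a == (b, c)) || (p a == (c, b))]].
have [mid midP] : exists mid : T -> T -> T, forall b c, h b c ->
    mid b c \in A /\ (p (mid b c) = (b, c) \/ p (mid b c) = (c, b)).
  have /choice[m mP] (bc : T * T) : exists a, h bc.1 bc.2 ->
      a \in A /\ (p a = bc \/ p a = (bc.2, bc.1)).
    case: bc => b c.
    case: (boolP (h b c)) => [|nh]; last by exists b => hbc; case/negP: nh.
    by case/exists_inP=> a aA /orP[]/eqP pa; exists a => _; split=> //; [left|right].
  by exists (fun b c => m (b, c)) => b c; apply: (mP (b, c)).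
have hB b c : h b c -> b \in B /\ c \in B.
  by case/exists_inP=> a /pP[_ _ _ b1 b2] /orP[]/eqP pa; rewrite pa in b1 b2.
have drh : drawing R h.
  apply: (@drawing_walks g _ (fun b c => [:: mid b c; c])) => //.
    move=> b c /midP[/pP[g1 g2 _ _ _] pm] /=; split=> //; rewrite sg andbT.
    by case: pm => pm; rewrite pm in g1 g2; rewrite g1 g2.
  move=> b c b' c' hbc hbc' /=; rewrite !inE => /and4P[/norP[_ /norP[ac ad]] /norP[bc bd] _ _].
  have [m1 m2] := midP _ _ hbc; have [m1' m2'] := midP _ _ hbc'.
  have [b1 b2] := hB _ _ hbc; have [b1' b2'] := hB _ _ hbc'.
  have mm : mid b c != mid b' c'.
    apply/eqP=> E; move: m2 m2'; rewrite E; case=> ->; case=> -[E1 E2];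
      by move: ac ad bc bd; rewrite ?E1 ?E2 ?eqxx.
  rewrite (eq_sym b' b) (eq_sym b' c) (eq_sym c' b) (eq_sym c' c).
  rewrite (eq_sym b' (mid _ _)) (eq_sym c' (mid _ _)) (eq_sym _ (mid b c)).
  rewrite (negPf (AB _ _ m1 b1')) (negPf (AB _ _ m1 b2')) (negPf (AB _ _ m1' b1)).
  by rewrite (negPf (AB _ _ m1' b2)) (negPf ac) (negPf ad) (negPf bc) (negPf bd) (negPf mm).
have sh : symmetric h by move=> b c; rewrite /h /=; under eq_existsb do rewrite orbC.
have ih : irreflexive h.
  move=> b; apply/negbTE/negP; case/exists_inP=> a /pP[_ _ n12 _ _].
  by case/orP=> /eqP pa; rewrite pa eqxx in n12.
have cardA : #|A| <= density * #|B|.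
  apply: leq_trans (drawing_density sh ih (drawing_sub _ drh)); last first.
    by move=> a b /= /and3P[].
  have -> : degree_sum B h = #|[set bc : T * T | h bc.1 bc.2]|.
    rewrite /degree_sum -sum1_card (eq_bigl (fun bc => (bc.1 \in B) && h bc.1 bc.2)); last first.
      by case=> b c; rewrite inE /=; case: (boolP (h b c)) => [/hB[->]|]; rewrite ?andbF.
    rewrite -(pair_big_dep [in B] h (fun _ _ => 1)) /=; apply: eq_bigr => b bB.
    rewrite -sum1_card; apply: eq_bigl => c; rewrite inE.
    by case: (boolP (h b c)) => [/hB[_ ->]|]; rewrite ?andbF.
  (* Two vertices with the same pair of neighbours would give a 4-cycle. *)
  have pI : {in A &, injective p}.
    move=> a a' aA a'A pE; apply/eqP; apply: contraT => aa'.
    have [g1 g2 n12 _ _] := pP _ aA; have [g1' g2' _ _ _] := pP _ a'A.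
    rewrite -pE in g1' g2'.
    by have := c4 a a' _ _ aa' n12 g1 g2 g1'; rewrite g2'.
  rewrite -(card_in_imset pI); apply: subset_leq_card; apply/subsetP=> _ /imsetP[a aA ->].
  rewrite inE; apply/exists_inP; exists a => //.
  by rewrite -surjective_pairing eqxx.
(* Neighbours of vertices in [B] are not isolated, so all degrees in [B] are counted inside
   [A :|: B]. *)
have cardB : light.+1 * #|B| <= density * #|A :|: B|.
  apply: leq_trans (drawing_density sg ig (drawing_sub _ dr)); last first.
    by move=> a b /= /and3P[].
  rewrite mulnC -sum_nat_const /degree_sum [X in _ <= X](big_setID B) /=.
  rewrite (setIidPr (subsetUr A B)); apply: leq_trans (leq_addr _ _).
  apply: leq_sum => b; rewrite inE => /leq_trans; apply.
  apply: subset_leq_card; apply/subsetP=> v; rewrite !inE => gbv.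
  by rewrite gbv andbT (deg_gt0 v b) ?(sg v) //= leqNgt orNb.
have := leq_trans cardB (leq_mul (leqnn density) (leq_card_setU A B)).
rewrite leqNgt mulSn /light -mulnA => /negP; apply.
have : density * (#|A| + #|B|) <= density * ((density + 1) * #|B|).
  by rewrite leq_mul2l mulnDl mul1n leq_add2r cardA orbT.
by move=> hh; apply: leq_ltn_trans hh _; rewrite -[X in X < _]add0n ltn_add2r.
Qed.
End Density.

(** * Colouring *)

Section DefectiveColoring.
Import mathcomp.boot.fintype mathcomp.boot.finset.
Local Open Scope set_scope.
Variables (R : realType) (T : finType).
Implicit Types (g : rel T).

Definition del_edge (x y : T) g : rel T :=
  fun a b => g a b && ~~ ((a == x) && (b == y) || (a == y) && (b == x)).
Arguments del_edge x y g a b /.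

(** Induction on the number of edges. A leaf takes the colour opposite to its neighbour; an edge
    between two vertices of degree at most [light] can be restored, as even their full degrees
    respect the bound. *)
Lemma c4_free_defective_coloring g : symmetric g -> irreflexive g ->
  c4_free g -> drawing R g ->
  exists c : T -> bool, forall v, #|[set w | g v w & c w == c v]| <= light.
Proof.
have [n] := ubnP #|[set p : T * T | g p.1 p.2]|.
elim: n g => // n IHn g; rewrite ltnS => gn sg ig c4 dr.
have IHe x y : g x y -> exists c : T -> bool,
    forall v, #|[set w | del_edge x y g v w & c w == c v]| <= light.
  move=> gxy; apply: IHn.
  - apply: leq_trans gn; apply: proper_card; apply/properP; split.
      by apply/subsetP=> -[a b]; rewrite !inE /= => /andP[].
    by exists (x, y); rewrite !inE /= ?gxy // !eqxx andbF.
  - move=> a b /=; rewrite sg; congr (_ && ~~ _); rewrite orbC.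
    by congr orb; rewrite andbC.
  - by move=> a; rewrite /= ig.
  - move=> u v a b uv ab /= /andP[h1 _] /andP[h2 _] /andP[h3 _].
    by rewrite (negPf (c4 _ _ _ _ uv ab h1 h2 h3)).
  - by apply: drawing_sub dr => a b /= /andP[].
have [|nodeg1] := boolP [exists u, #|[set v | g u v]| == 1].
  case/existsP=> u /cards1P[w Nu].
  have gu v : g u v = (v == w) by have /setP/(_ v) := Nu; rewrite !inE.
  have uw : u != w by apply/eqP=> uw; have := ig u; rewrite gu uw eqxx.
  have [c cP] := IHe u w ltac:(by rewrite gu).
  exists (fun v => if v == u then ~~ c w else c v) => v.
  have [->|vu] := eqVneq v u.
    rewrite (_ : [set _ | _] = set0) ?cards0 //; apply/setP=> b; rewrite !inE gu.
    by have [->|//] := eqVneq b w; rewrite ?(eq_sym w u) (negPf uw) /=; case: (c w).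
  apply: leq_trans (cP v); apply: subset_leq_card; apply/subsetP=> b; rewrite !inE /=.
  have [->|bu] := eqVneq b u.
    by rewrite sg gu => /andP[/eqP->]; case: (c w).
  by rewrite (negPf vu) (andbF (v == w)) /= andbT.
have [/existsP[u0 /existsP[v0 g0]]|noedge] := boolP [exists u, exists v, g u v]; last first.
  exists (fun=> true) => v; rewrite (_ : [set _ | _] = set0) ?cards0 //.
  apply/setP=> w; rewrite !inE eqxx andbT; apply/negbTE; apply: contra noedge => gvw.
  by apply/existsP; exists v; apply/existsP; exists w.
have [] := light_edge sg ig c4 dr.
- by move=> u; apply: contra nodeg1 => /eqP du; apply/existsP; exists u; apply/eqP.
- by exists u0, v0.
move=> u [v [guv du dv]]; have [c cP] := IHe _ _ guv; exists c => w.
have sub x : #|[set y | g x y & c y == c x]| <= #|[set y | g x y]|.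
  by apply: subset_leq_card; apply/subsetP=> y; rewrite !inE => /andP[].
have [->|wu] := eqVneq w u; first exact: leq_trans (sub u) du.
have [->|wv] := eqVneq w v; first exact: leq_trans (sub v) dv.
apply: leq_trans (cP w); apply: subset_leq_card; apply/subsetP=> y.
by rewrite !inE /= (negPf wu) (negPf wv) /= andbT.
Qed.

End DefectiveColoring.

(** * Graphs without odd cycles *)

Section Bipartite.

Lemma not_uniq_split (T : eqType) (c : seq T) : ~~ uniq c ->
  exists x s1 s2 s3, c = s1 ++ x :: s2 ++ x :: s3.
Proof.
elim: c => //= y c IHc; rewrite negb_and negbK => /orP[|/IHc[x [s1 [s2 [s3 ->]]]]].
  by case/splitPr=> s2 s3; exists y, [::], s2, s3.
by exists x, (y :: s1), s2, s3.
Qed.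

(** At a repeated vertex a closed walk splits into two shorter closed walks, one of them odd. *)
Lemma odd_closed_walk_cycle (T : eqType) (g : rel T) (c : seq T) :
  cycle g c -> odd (size c) -> exists2 c', ucycle g c' & odd (size c').
Proof.
have [n] := ubnP (size c); elim: n c => // n IHn c; rewrite ltnS => cn gc oc.
have [uc|] := boolP (uniq c); first by exists c => //; rewrite /ucycle gc uc.
case/not_uniq_split=> x [s1 [s2 [s3 E]]].
have rE : rot (size s1) c = x :: s2 ++ x :: (s3 ++ s1) by rewrite E rot_size_cat /= -catA.
have sE : size c = (size s2).+1 + (size (s3 ++ s1)).+1.
  by rewrite -(size_rot (size s1)) rE /= size_cat.
move: gc; rewrite -(rot_cycle (size s1)) rE /= rcons_cat cat_path /=.
rewrite andbA -rcons_path => /andP[c2 c3].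
move: oc; rewrite sE oddD => oc.
have [o2|e2] := boolP (odd (size s2).+1).
  by apply: (IHn (x :: s2)) => //=; apply: leq_trans cn; rewrite sE; lia.
apply: (IHn (x :: (s3 ++ s1))) => //=; last by move: oc; rewrite (negPf e2).
by apply: leq_trans cn; rewrite sE; lia.
Qed.

(** The colour is the parity of a walk from the root of the component; walks of different parity to
    one vertex would close up to an odd walk. *)
Lemma no_odd_cycle_bipartite (T : finType) (g : rel T) : symmetric g ->
  (forall c, ucycle g c -> ~~ odd (size c)) ->
  exists c : T -> bool, forall u v, g u v -> c u != c v.
Proof.
move=> sg noodd.
have csym := sym_connect_sym sg.
have parity r p q : path g r p -> path g r q -> last r p = last r q ->
    odd (size p) = odd (size q).
  move=> gp gq pq; pose s := p ++ rev (belast r q).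
  have gs : path g r s.
    by rewrite cat_path gp pq rev_path (eq_path (e' := g)) // => x y; rewrite sg.
  have ls : last r s = r.
    by rewrite last_cat; case: (q) pq => //= y q' _; rewrite rev_cons last_rcons.
  have os : odd (size s) = odd (size p) (+) odd (size q).
    by rewrite size_cat size_rev size_belast oddD.
  have [odds|] := boolP (odd (size s)); last by rewrite os; do 2!case: (odd _).
  have cs : cycle g s.
    by case: (s) gs ls => //= x s' gs ls; rewrite rcons_path -ls andbC in gs *.
  by have [c /noodd/negP] := odd_closed_walk_cycle cs odds.
have /choice[f fP] v : exists p, path g (fingraph.root g v) p /\ last (fingraph.root g v) p = v.
  have : connect g (fingraph.root g v) v by rewrite csym connect_root.
  by case/connectP=> p gp lp; exists p.
exists (fun v => odd (size (f v))) => u v guv.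
have ruv : fingraph.root g u = fingraph.root g v by apply/(fingraph.rootP csym)/connect1.
have [pu lu] := fP u; have [pv lv] := fP v.
rewrite -(parity (fingraph.root g v) (rcons (f u) v) (f v)) //.
- by rewrite size_rcons /=; case: (odd _).
- by rewrite -ruv rcons_path pu lu.
- by rewrite last_rcons.
Qed.
End Bipartite.

(** * From planarity to drawings *)

Section PlanarDrawing.
Local Open Scope classical_set_scope.
Local Open Scope ring_scope.
Variable R : realType.
Implicit Types (A B : set (R * R)) (p q : R * R) (e : R).

Lemma ball_near_pt p q e : ball p e q = (near_pt e p q : Prop).
Proof. by rewrite propeqE; split=> [[b1 b2]|/andP[b1 b2]]; [apply/andP|split]. Qed.

Lemma near_ptC e p q : near_pt e p q = near_pt e q p.
Proof. by rewrite /near_pt distrC [`|p.2 - _|]distrC. Qed.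

(** Each point of [A] has positive distance from the closed set [B], and compactness makes this
    uniform. The form near 0 lets finitely many pairs of arcs share one scale. *)
Lemma compact_apart A B : compact A -> compact B -> A `&` B `<=` set0 ->
  \forall e \near 0^'+, forall p q, A p -> B q -> ~~ near_pt (2 * e) p q.
Proof.
move=> cA cB AB.
have clB : closed B by apply: compact_closed cB; exact: norm_hausdorff.
have /compact_near_coveringP/(_ _ (0^'+ : set_system R)
    (fun e p => forall q, B q -> ~~ near_pt (2 * e) p q)) := cA.
have H : forall p, A p -> \forall p' \near p & e \near 0^'+,
    forall q, B q -> ~~ near_pt (2 * e) p' q.
  move=> p Ap.
  have : nbhs p (~` B).
    by apply: open_nbhs_nbhs; split; [exact: closed_openC|move=> Bp; exact: (AB p)].
  case/nbhs_ballP=> r /= r0 rB.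
  exists (ball p (r / 2), [set e | e < r / 4]) => /=.
    by split; [apply: nbhsx_ballx; lra|apply: nbhs_right_lt; lra].
  move=> [p' e] /= [pp' er] q Bq; apply/negP => p'q; apply: (rB q) => //.
  rewrite [r]splitr; apply: ball_triangle pp' _.
  rewrite ball_near_pt; case/andP: p'q => h1 h2; apply/andP; split; lra.
by move=> /(_ _ H); apply: filterS => e K p q /K; exact.
Qed.

(** The points of [A] reached by such chains form a nonempty subset that is open and closed in
    [A]. *)
Lemma connected_chain A p q e : connected A -> A p -> A q -> 0 < e ->
  exists s, [/\ path (near_pt e) p s, last p s = q & forall x, x \in s -> A x].
Proof.
move=> cA Ap Aq e0.
pose B := [set x | exists s, [/\ path (near_pt e) p s, last p s = x & forall x, x \in s -> A x]].
pose reached := A `&` B.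
have step x y : reached x -> A y -> near_pt e x y -> reached y.
  move=> [_ [s [ps ls As]]] Ay xy; split=> //; exists (rcons s y); split.
  - by rewrite rcons_path ps ls.
  - by rewrite last_rcons.
  - by move=> z; rewrite mem_rcons inE => /orP[/eqP->|/As].
suff AE : reached = A by have [] : reached q by rewrite AE.
apply: cA.
- by exists p; split=> //; exists [::].
- exists (\bigcup_(x in reached) ball x e).
    by apply: bigcup_open => x _; exact: ball_open.
  apply/seteqP; split=> [x rx|x [Ax [y ry]]].
    by split; [case: rx|exists x => //; exact: ballxx].
  by rewrite ball_near_pt => yx; apply: step ry Ax yx.
- exists (~` \bigcup_(x in A `\` reached) ball x e).
    apply: open_closedC; apply: bigcup_open => x _; exact: ball_open.
  apply/seteqP; split=> [x rx|x [Ax nx]].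
    split; [by case: rx|move=> [y [Ay nry]]].
    by rewrite ball_near_pt near_ptC => xy; apply: nry; apply: step rx Ay xy.
  by apply: contrapT => nrx; apply: nx; exists x => //; exact: ballxx.
Qed.

Lemma planar_drawing (G : sgraph) : planar R G -> drawing R (@adj G).
Proof.
case=> pos [arc] [posI arcP arcV arcX].
pose A (u v : G) := arc [set u; v]%SET.
have ends u v : adj u v -> A u v (pos u) /\ A u v (pos v).
  rewrite /A => /arcP[f [_ _ <- <- <-]]; split; [exists 0|exists 1] => //=;
    by rewrite in_itv /= lexx ler01.
have arc_compact u v : adj u v -> compact (A u v).
  case/arcP=> f [cf _ _ _]; rewrite /A => <-.
  by apply: continuous_compact => //; exact: segment_compact.
have arc_connected u v : adj u v -> connected (A u v).
  case/arcP=> f [cf _ _ _]; rewrite /A => <-.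
  by apply: connected_continuous_connected => //; exact: segment_connected.
have disj u v a b : adj u v -> adj a b -> uniq [:: u; v; a; b] ->
    A u v `&` A a b `<=` set0.
  move=> guv gab /=; rewrite !inE !negb_or => /and4P[/and3P[_ ua ub] /andP[va vb] _ _] x Ax.
  have Ee c d : adj c d -> [set c; d]%SET \in edges G.
    by move=> gcd; rewrite inE; apply/existsP; exists c; apply/existsP; exists d; rewrite gcd /=.
  have nE : [set u; v]%SET != [set a; b]%SET.
    by apply/eqP=> /setP/(_ u); rewrite !inE eqxx (negPf ua) (negPf ub).
  (* A common point is the position of a vertex, which would belong to both edges. *)
  have [w _ xw] := arcX _ _ (Ee _ _ guv) (Ee _ _ gab) nE x Ax.
  rewrite -xw in Ax; case: Ax => /(arcV _ _ (Ee _ _ guv)) + /(arcV _ _ (Ee _ _ gab)).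
  by rewrite !inE => /orP[]/eqP->; rewrite ?(negPf ua) ?(negPf ub) ?(negPf va) ?(negPf vb).
have sep : \forall e \near 0^'+, forall t : G * G * G * G,
    let: (u, v, a, b) := t in
    adj u v -> adj a b -> uniq [:: u; v; a; b] ->
    forall p q, A u v p -> A a b q -> ~~ near_pt (2 * e) p q.
  apply: filter_forall => -[[[u v] a] b].
  have [[guv gab uq]|no] := pselect [/\ adj u v, adj a b & uniq [:: u; v; a; b]].
    have := compact_apart (arc_compact _ _ guv) (arc_compact _ _ gab) (disj _ _ _ _ guv gab uq).
    by apply: filterS => e H _ _ _; exact: H.
  by apply: nearW => e guv gab uq; case: no.
have [e [e0 eP]] := filter_ex (filterI (nbhs_right_gt (0 : R)) sep).
have /choice[ch chP] (t : G * G) : exists s, adj t.1 t.2 ->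
    [/\ path (near_pt e) (pos t.1) s, last (pos t.1) s = pos t.2
      & forall x, x \in s -> A t.1 t.2 x].
  case: t => u v /=; have [guv|] := boolP (adj u v); last by exists [::].
  have [Au Av] := ends _ _ guv.
  by have [s sP] := connected_chain (arc_connected _ _ guv) Au Av e0; exists s.
exists e, pos, (fun u v => ch (u, v)); split=> //.
  by move=> u v /(chP (u, v))[].
move=> u v a b guv gab uq p q pu qa; apply: (eP (u, v, a, b) guv gab uq).
  by move: pu; rewrite inE => /orP[/eqP->|]; [case: (ends _ _ guv)
    |case: (chP (u, v) guv)=> _ _; exact].
by move: qa; rewrite inE => /orP[/eqP->|]; [case: (ends _ _ gab)
    |case: (chP (a, b) gab)=> _ _; exact].
Qed.

End PlanarDrawing.

(** * Graphs with few cycle lengths *)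

Section Necklace.
Import mathcomp.boot.fintype mathcomp.boot.finset.
Local Open Scope set_scope.
Variables (i D : nat).
Hypothesis i_gt0 : 0 < i.

(* A vertex is a triple (copy, level, branch); the branch is only free at odd
   levels, and all copies share the hub at level 0. *)
Definition necklace_norm (t : 'I_D.+1 * 'I_(2 * i).+1 * 'I_(2 * D).+1) :=
  let: (j, x, q) := t in
  (if x == ord0 then ord0 else j, x, if odd x then q else ord0).

Definition necklace_vertex := {t | necklace_norm t == t}.
Implicit Types u v w x y z : necklace_vertex.

Definition copy v : nat := (val v).1.1.
Definition level v : nat := (val v).1.2.
Definition branch v : nat := (val v).2.

Lemma necklace_normK t : necklace_norm (necklace_norm t) == necklace_norm t.
Proof.
case: t => [[j x] q] /=; apply/eqP.
by case: (x == _); case: (odd x).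
Qed.

Definition mk j a q : necklace_vertex :=
  exist (fun t => necklace_norm t == t) _ (necklace_normK (j, a, q)).

Lemma level_le v : level v <= 2 * i.
Proof. by rewrite -ltnS ltn_ord. Qed.

Lemma branch_le v : branch v <= 2 * D.
Proof. by rewrite -ltnS ltn_ord. Qed.

Lemma copy0 v : level v = 0 -> copy v = 0.
Proof.
rewrite /level /copy; case: v => [[[j x] q] /= /eqP[jE _] x0].
by rewrite -jE ifT //; apply/eqP/val_inj.
Qed.

Lemma branch0 v : ~~ odd (level v) -> branch v = 0.
Proof.
rewrite /level /branch; case: v => [[[j x] q] /= /eqP[_ qE] x0].
by rewrite -qE (negPf x0).
Qed.

Lemma vertex_eq u v :
  level u = level v -> copy u = copy v -> branch u = branch v -> u = v.
Proof.
rewrite /level /copy /branch => h1 h2 h3; apply/val_inj.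
by case: (val u) (val v) h1 h2 h3 => [[? ?] ?] [[? ?] ?] /= /val_inj-> /val_inj-> /val_inj->.
Qed.

(** The hub, at level 0, counts as a member of every copy. *)
Definition linked u v := [|| level u == 0, level v == 0 | copy u == copy v].

Definition necklace_step (a b : nat) :=
  [|| b == a.+1, a == b.+1, (a == 0) && (b == 2 * i) | (a == 2 * i) && (b == 0)].

Definition necklace_adj : rel necklace_vertex :=
  fun u v => linked u v && necklace_step (level u) (level v).

Lemma necklace_adj_sym : symmetric necklace_adj.
Proof.
move=> u v; rewrite /necklace_adj /linked /necklace_step orbCA (eq_sym (copy u)).
congr andb; rewrite orbCA; congr orb; congr orb.
by rewrite orbC; congr orb; rewrite andbC.
Qed.

Lemma necklace_adj_irrefl : irreflexive necklace_adj.
Proof.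
move=> u; apply/negP=> /andP[_]; rewrite /necklace_step; have := i_gt0; lia.
Qed.

Definition necklace := SGraph necklace_adj_sym necklace_adj_irrefl.

Lemma even_vertex_eq u v : level u = level v -> ~~ odd (level u) -> linked u v -> u = v.
Proof.
move=> luv ev lk; apply: vertex_eq => //; last by rewrite !branch0 -?luv.
case/or3P: lk => /eqP // l0; first by rewrite !copy0 -?luv.
by rewrite !copy0 ?luv.
Qed.

Lemma adjP u v : necklace_adj u v ->
  linked u v /\ [\/ level v = (level u).+1, level u = (level v).+1,
     level u = 0 /\ level v = 2 * i | level u = 2 * i /\ level v = 0].
Proof.
case/andP=> lk st; split=> //; move: st; rewrite /necklace_step.
by case/or4P=> [/eqP|/eqP|/andP[/eqP ? /eqP ?]|/andP[/eqP ? /eqP ?]];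
  [constructor 1|constructor 2|constructor 3|constructor 4].
Qed.

Lemma linked_trans u v w : level v != 0 -> linked u v -> linked v w -> linked u w.
Proof.
by rewrite /linked => /negPf-> /= /orP[->//|/eqP->] /orP[->|->]; rewrite ?orbT.
Qed.

Lemma linkedC u v : linked u v = linked v u.
Proof. by rewrite /linked orbCA (eq_sym (copy u)). Qed.

Lemma odd_nbrs_eq y u v : odd (level y) -> necklace_adj y u -> necklace_adj y v ->
  level u = level v -> u = v.
Proof.
move=> oy /adjP[lu su] /adjP[lv sv] luv.
apply: even_vertex_eq => //; last first.
  by apply: linked_trans lv; [apply: contraTneq oy => ->|rewrite linkedC].
by case: su => [->|su|[l0]|[l0]]; rewrite /= ?oy //; move: oy; rewrite ?su ?l0 /= ?oddM.
Qed.

(** Besides [w], both [y] and [z] have a single neighbour, the vertex of the copy two levels below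
    [w], so the cycle closes up there. *)
Lemma four_cycle w y z p : ~~ odd (level w) -> 0 < level w ->
  level y = (level w).-1 -> level z = (level w).-1 ->
  cycle necklace_adj (w :: y :: rcons p z) -> uniq (w :: y :: rcons p z) -> size p = 1.
Proof.
move=> ew w0 ly lz /= cy /and3P[wN yN un].
have oy : odd (level y) by rewrite ly; move: ew w0; case: (level w) => //= n; rewrite negbK.
have oz : odd (level z) by rewrite lz -ly.
case/andP: cy => awy; rewrite rcons_path last_rcons => /andP[pth azw].
have up v t : odd (level t) -> level t = (level w).-1 -> necklace_adj t w ->
    necklace_adj t v -> v != w -> level v = (level w).-2.
  move=> ot lt atw atv vw; have [lk] := adjP atv.
  case=> [E|E|[E _]|[E _]].
  - by case/eqP: vw; apply: (odd_nbrs_eq ot atv atw); rewrite E lt prednK.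
  - by rewrite -lt E.
  - by rewrite E in ot.
  - by rewrite E oddM in ot.
case: p pth wN yN un => [|y2 p] /=.
  case/andP=> /adjP[_ st] _; case: st => [E|E|[E _]|[E _]].
  - by case: (n_Sn (level w).-1); rewrite -{1}lz -ly.
  - by case: (n_Sn (level w).-1); rewrite -{1}ly -lz.
  - by rewrite E in oy.
  - by rewrite E oddM in oy.
case/andP=> ayy2 pth; rewrite !inE !negb_or => /and3P[wy wy2 wp] /andP[yy2 yp] /andP[y2p up'].
have ly2 := up _ _ oy ly (etrans (necklace_adj_sym _ _) awy) ayy2.
have {ly2} ly2 : level y2 = (level w).-2 by apply: ly2; rewrite eq_sym.
move: pth; rewrite rcons_path => /andP[pth alz].
case/lastP: p pth alz wp yp y2p up' => // p t; rewrite last_rcons => pth alz wp yp y2p up'.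
have tw : t != w by apply: contraNneq wp => <-; rewrite mem_rcons inE mem_rcons inE eqxx orbT.
have lt := up t z oz lz azw (etrans (necklace_adj_sym _ _) alz) tw.
have y2t : y2 = t.
  apply: even_vertex_eq; rewrite ?ly2 ?lt //.
    by move: ew; case: (level w) => [|[|n]] //=; rewrite negbK.
  have y0 : level y != 0 by apply: contraTneq oy => ->.
  have z0 : level z != 0 by apply: contraTneq oz => ->.
  have w0' : level w != 0 by rewrite -lt0n.
  have [lk1 _] := adjP ayy2; have [lk2 _] := adjP awy.
  have [lk3 _] := adjP azw; have [lk4 _] := adjP alz.
  apply: linked_trans (_ : linked y2 y) _ => //; first by rewrite linkedC.
  apply: linked_trans (_ : linked y w) _ => //; first by rewrite linkedC.
  apply: linked_trans (_ : linked w z) _ => //; first by rewrite linkedC.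
  by rewrite linkedC.
by case/negP: y2p; rewrite y2t mem_rcons inE mem_rcons inE eqxx orbT.
Qed.

(** The closing edge from the last level to the hub is excluded, and so are higher even vertices of
    the copy; hence any two edges of a path to the hub descend two levels. *)
Lemma descent l x s : level x = (2 * l.+1)%N -> path necklace_adj x s -> uniq (x :: s) ->
  level (last x s) = 0 -> (level x < 2 * i) || (1 < size s) ->
  (forall v, v \in s -> copy v = copy x -> ~~ odd (level v) -> level v <= level x) ->
  size s = (2 * l.+1)%N.
Proof.
have last0 (v : necklace_vertex) r : level v = 0 -> level (last v r) = 0 -> uniq (v :: r) ->
    r = [::].
  move=> lv; case/lastP: r => // r t; rewrite last_rcons => lt /= /andP[vr _].
  case/negP: vr; rewrite mem_rcons inE (_ : v = t) ?eqxx //.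
  by apply: even_vertex_eq; rewrite ?lv ?lt // /linked lv.
have step x' s' : 0 < level x' -> ~~ odd (level x') -> path necklace_adj x' s' ->
    uniq (x' :: s') -> level (last x' s') = 0 ->
    (level x' < 2 * i) || (1 < size s') ->
    (forall v, v \in s' -> copy v = copy x' -> ~~ odd (level v) -> level v <= level x') ->
    exists y y2 s2, [/\ s' = [:: y, y2 & s2], (level y2).+2 = level x' &
      level y2 != 0 -> copy y2 = copy x'].
  move=> x0 ex; case: s' => [|y s'] /=; first by move=> _ _ lx0; rewrite lx0 in x0.
  move=> /andP[axy pth'] /andP[xN uq'] ls' hd' top'.
  have [lk st] := adjP axy.
  have oy : odd (level y).
    case: st => [->|E|[E _]|[E ly]]; rewrite /= ?ex //.
    - by move: ex; rewrite E /= negbK.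
    - by rewrite E in x0.
    - have := last0 _ _ ly ls' uq' => s0; move: hd'; rewrite s0 /= E ltnn //.
  case: s' pth' xN uq' ls' hd' top' => [|y2 s2] /=.
    by move=> _ _ _ ly0; rewrite ly0 in oy.
  move=> /andP[ayy2 pth'] xN uq' ls' _ top'; exists y, y2, s2.
  have [lk2 st2] := adjP ayy2.
  have ne : level y2 <> level x'.
    move=> E; move: xN; rewrite !inE (odd_nbrs_eq oy ayy2 _ E) ?eqxx ?orbT //.
    by rewrite necklace_adj_sym.
  have y0 : level y != 0 by apply: contraTneq oy => ->.
  have lk3 : linked x' y2 by apply: linked_trans lk lk2.
  have cp : level y2 != 0 -> copy y2 = copy x'.
    move=> l2; move: lk3; rewrite /linked (negPf l2) => /orP[/eqP x'0|/eqP-> //].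
    by rewrite x'0 in x0.
  have ey2 : ~~ odd (level y2).
    by case: st2 => [->|E|[E _]|[E _]]; rewrite /= ?oy //; move: oy;
      rewrite E /= ?oddM // negbK => /negPf->.
  split=> //.
  case: st2 => [E2|E2|[E2 _]|[E2 _]]; [| |by rewrite E2 in oy|by rewrite E2 oddM in oy].
    case: st => [E|E|[E _]|[_ E]];
      [|by case: ne; rewrite E2 E|by rewrite E in x0|by rewrite E in oy].
    have : level y2 <= level x' by apply: top'; rewrite ?inE ?eqxx ?orbT ?cp // E2.
    by rewrite E2 E ltnNge leqnSn.
  case: st => [E|E|[E _]|[_ E]];
    [by case: ne; apply: succn_inj; rewrite -E2 -E|by rewrite E E2
    |by rewrite E in x0|by rewrite E in oy].
elim: l x s => [|l IHl] x s lx pth uq ls hd top.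
  have [y [y2 [s2 [sE ly2 _]]]] :=
    step x s ltac:(by rewrite lx) ltac:(by rewrite lx oddM) pth uq ls hd top.
  have y20 : level y2 = 0 by move: ly2; rewrite lx => -[].
  rewrite {}sE /= in uq ls *; case/and3P: uq => _ _ uq.
  by rewrite (last0 _ _ y20 ls uq).
have [y [y2 [s2 [sE ly2 cp]]]] :=
    step x s ltac:(by rewrite lx) ltac:(by rewrite lx oddM) pth uq ls hd top.
have {}ly2 : level y2 = (2 * l.+1)%N by clear -ly2 lx; lia.
rewrite {}sE /= in pth uq ls top *; case/and3P: pth => _ _ pth; case/and3P: uq => xN _ uq.
rewrite (IHl y2 s2) //; first by rewrite [RHS]mulnS.
  by apply/orP; left; apply: leq_trans (level_le x); rewrite ly2 lx ltn_mul2l /=.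
have {}cp : copy y2 = copy x by apply: cp; rewrite ly2.
(* An even vertex as high as [x] would be [x] itself, which the path has left; by parity the others
   are at most as high as [y2]. *)
move=> v vs cv ev; have : level v <= level x.
  by apply: top; rewrite ?inE ?vs ?orbT // cv.
have : level v <> level x.
  move=> E; have vx : v = x by apply: even_vertex_eq => //; rewrite /linked cv cp eqxx !orbT.
  by move: xN; rewrite !inE -vx vs !orbT.
by move: ev; rewrite lx ly2; clear; lia.
Qed.

Lemma top_cycle w p : level w = 2 * i -> level (last w p) = 0 -> 1 < size p ->
  cycle necklace_adj (w :: p) -> uniq (w :: p) -> size p = 2 * i.
Proof.
move=> lw lz p1; rewrite /= rcons_path => /andP[pth _] uq.
rewrite -(prednK i_gt0); apply: (@descent _ w) => //.
- by rewrite prednK.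
- by rewrite p1 orbT.
- by move=> v _ _ _; rewrite lw level_le.
Qed.

(** A vertex [w] of maximal level in a cycle has even level, as its two neighbours differ. If both
    lie just below [w], the length is 4; otherwise the cycle uses the closing edge and descends
    through a whole copy. *)
Lemma necklace_cycles k : 3 <= k -> contains_cycle necklace k -> k = 4 \/ k = 2 * i + 1.
Proof.
move=> k3 [c [sc /andP[cy uq]]].
have [v0 v0c] : exists v, v \in c.
  by case: c sc {cy uq} => [k0|v c _]; [rewrite -k0 in k3|exists v; rewrite inE eqxx].
case: (arg_maxnP (P := [in c]) level v0c) => w wc wmax.
case/rot_to: wc => n p rE.
have {cy} cy : cycle necklace_adj (w :: p) by rewrite -rE rot_cycle.
have {uq} uq : uniq (w :: p) by rewrite -rE rot_uniq.
have {sc} sp : (size p).+1 = k by rewrite -sc -(size_rot n c) rE.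
have {}wmax v : v \in p -> level v <= level w.
  by move=> vp; apply: wmax; rewrite /= -(mem_rot n) rE inE vp orbT.
case: p cy uq sp wmax {rE} => [|y p]; first by move=> _ _ k1; rewrite -k1 in k3.
case/lastP: p => [|p z]; first by move=> _ _ k2; rewrite -k2 in k3.
move=> cy uq sp wmax.
have yz : y != z by case/and3P: uq => _; rewrite mem_rcons inE negb_or => /andP[].
have awy : necklace_adj w y by case/andP: cy.
have awz : necklace_adj w z.
  by rewrite necklace_adj_sym; move: cy; rewrite /= rcons_path last_rcons => /andP[_ /andP[]].
have down v : v \in y :: rcons p z -> necklace_adj w v ->
    level w = (level v).+1 \/ (level w = 2 * i /\ level v = 0).
  move=> /wmax vw /adjP[_ []] => [E|E|[E1 E2]|E]; [|by left| |by right].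
    by move: vw; rewrite E ltnn.
  by move: vw; rewrite E1 E2 leqn0 muln_eq0 /= => /eqP i0; have := i_gt0; rewrite i0.
have yI : y \in y :: rcons p z by rewrite inE eqxx.
have zI : z \in y :: rcons p z by rewrite inE mem_rcons inE eqxx orbT.
have [ow|ew] := boolP (odd (level w)).
  case/eqP: yz; apply: (odd_nbrs_eq ow awy awz).
  have even2i : level w <> 2 * i by move=> E; rewrite E oddM in ow.
  case: (down y yI awy) => [Ey|[/even2i //]]; case: (down z zI awz) => [Ez|[/even2i //]].
  by apply: succn_inj; rewrite -Ey.
case: (down z zI awz) => [Ez|[lw lz]]; last first.
  right; rewrite -sp addn1; congr _.+1; apply: (top_cycle lw _ _ cy uq) => //=.
    by rewrite last_rcons.
  by rewrite size_rcons.
case: (down y yI awy) => [Ey|[lw ly]]; last first.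
  (* The hub follows [w] directly, so the cycle is read backwards. *)
  right; rewrite -sp addn1 -size_rev; congr _.+1; apply: (@top_cycle w) => //.
  - by rewrite rev_cons last_rcons.
  - by rewrite size_rev /= size_rcons.
  - rewrite -(rot_cycle 1) rot1_cons -rev_cons rev_cycle.
    by rewrite (eq_cycle (e' := necklace_adj)) // => a b; rewrite necklace_adj_sym.
  - by rewrite cons_uniq mem_rev rev_uniq.
left; rewrite -sp /= size_rcons (@four_cycle w y z p) //.
- by rewrite Ez.
- by rewrite Ey.
- by rewrite Ez.
Qed.

Lemma mk_level j a q : level (mk j a q) = a. Proof. by []. Qed.

Lemma mk_copy j (a : 'I_(2 * i).+1) q : (a : nat) != 0 -> copy (mk j a q) = j.
Proof. by move=> a0; rewrite /copy /= ifN. Qed.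

Lemma mk_branch j (a : 'I_(2 * i).+1) q : odd a -> branch (mk j a q) = q.
Proof. by rewrite /branch /= => ->. Qed.

Lemma necklace_not_colorable : ~ colorable (fun _ : 'I_2 => D) necklace.
Proof.
case=> c cP.
pose bead (j : 'I_D.+1) l := mk j (inord (2 * l)) ord0.
have lbead j l : l <= i -> level (bead j l) = 2 * l.
  by move=> li; rewrite mk_level inordK // ltnS leq_mul2l li orbT.
have cbead j l : 0 < l <= i -> copy (bead j l) = j.
  move=> /andP[l0 li]; rewrite mk_copy // inordK ?ltnS ?leq_mul2l ?li ?orbT //.
  by rewrite muln_eq0 -lt0n l0.
have same_color j l : l < i -> c (bead j l) = c (bead j l.+1).
  move=> li; apply/eqP; apply: contraT => ne.
  pose mid (q : 'I_(2 * D).+1) := mk j (inord (2 * l).+1) q.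
  have li2 : (2 * l).+1 < (2 * i).+1 by rewrite ltnS ltn_mul2l.
  have lmid q : level (mid q) = (2 * l).+1 by rewrite mk_level inordK.
  have cmid q : copy (mid q) = j by rewrite mk_copy // inordK.
  have bmid q : branch (mid q) = q by rewrite mk_branch // inordK //= oddM.
  have a1 q : necklace_adj (bead j l) (mid q).
    rewrite /necklace_adj /necklace_step lbead ?lmid ?eqxx ?andbT 1?ltnW //.
    rewrite /linked lbead 1?ltnW //; case: (posnP l) => [->//|l0].
    by rewrite cmid cbead ?l0 1?ltnW // eqxx !orbT.
  have a2 q : necklace_adj (bead j l.+1) (mid q).
    rewrite necklace_adj_sym /necklace_adj /necklace_step lbead ?lmid // mulnS eqxx andbT.
    by rewrite /linked cmid cbead // eqxx !orbT.
  have midI : injective mid by move=> q q' E; apply/val_inj; rewrite /= -!bmid E.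
  (* Each middle vertex has the colour of one of the two differently coloured beads and counts
     towards its defect. *)
  have : #|[set mid q | q : 'I_(2 * D).+1]| <= D + D.
    apply: leq_trans (leq_add (cP (bead j l)) (cP (bead j l.+1))).
    apply: leq_trans (leq_card_setU _ _); apply: subset_leq_card.
    apply/subsetP=> _ /imsetP[q _ ->]; rewrite !inE /= a1 a2 /=.
    by move: ne; case: (c _) => -[|[|]] // ?; case: (c _) => -[|[|]] // ?; case: (c _) => -[|[|]].
  by rewrite card_imset // card_ord addnn -mul2n ltnn.
have hub_color j : c (bead j i) = c (bead j 0).
  suff H l : l <= i -> c (bead j l) = c (bead j 0) by exact: H.
  by elim: l => // l IHl li; rewrite -same_color // IHl // ltnW.
have hubE j : bead j 0 = bead ord0 0.
  by apply: even_vertex_eq; rewrite ?lbead // /linked lbead.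
have beadI : injective (bead^~ i).
  by move=> j j' E; apply/val_inj; rewrite /= -(cbead j i) ?E ?cbead ?i_gt0 /=.
have : #|[set bead j i | j : 'I_D.+1]| <= D.
  apply: leq_trans (cP (bead ord0 0)); apply: subset_leq_card.
  apply/subsetP=> _ /imsetP[j _ ->]; rewrite inE hub_color hubE eqxx andbT /=.
  by rewrite /necklace_adj /linked /necklace_step !lbead // eqxx !orbT.
by rewrite card_imset // card_ord ltnn.
Qed.

End Necklace.

(** * Straight-line drawings *)

Section StraightLine.
Local Open Scope classical_set_scope.
Local Open Scope ring_scope.
Variable R : realType.
Implicit Types (p q : R * R) (t : R).

Definition seg p q t : R * R :=
  ((1 - t) * p.1 + t * q.1, (1 - t) * p.2 + t * q.2).

Lemma seg0 p q : seg p q 0 = p.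
Proof. by case: p => a b; rewrite /seg /= subr0 !mul1r !mul0r !addr0. Qed.

Lemma seg1 p q : seg p q 1 = q.
Proof. by case: q => a b; rewrite /seg /= subrr !mul0r !mul1r !add0r. Qed.

Lemma segC p q t : seg q p t = seg p q (1 - t).
Proof. by rewrite /seg; congr pair; ring. Qed.

Lemma segxx p t : seg p p t = p.
Proof. by case: p => a b; rewrite /seg /=; congr pair; ring. Qed.

Lemma seg_inj p q : p != q -> injective (seg p q).
Proof.
move=> pq t s [e1 e2]; apply/eqP; rewrite -subr_eq0; apply: contraT => ts.
have aux (a b : R) : (1 - t) * a + t * b = (1 - s) * a + s * b -> a = b.
  move=> e; apply/eqP; rewrite -subr_eq0 -(mulrI_eq0 _ (mulfI ts)); apply/eqP.
  transitivity ((1 - s) * a + s * b - ((1 - t) * a + t * b)); first by ring.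
  by rewrite e subrr.
by case/eqP: pq; case: p q e1 e2 => [a b] [c d] /= /aux-> /aux->.
Qed.

Lemma seg_continuous p q : continuous (seg p q).
Proof.
have lin (a b : R) : continuous (fun t : R => (1 - t) * a + t * b).
  move=> t; apply: cvgD; apply: cvgM; do ?exact: cvg_cst; do ?exact: cvg_id.
  by apply: cvgB; [exact: cvg_cst|exact: cvg_id].
by move=> t; exact: (cvg_pair (lin p.1 q.1 t) (lin p.2 q.2 t)).
Qed.

Lemma seg_arc p q : p != q -> is_arc (seg p q @` `[0, 1]) p q.
Proof.
move=> pq; exists (seg p q); split; rewrite ?seg0 ?seg1 //.
  by apply: continuous_subspaceT; exact: seg_continuous.
by move=> t s _ _; exact: seg_inj.
Qed.

(** [dir] orients the edges, so that the geometric conditions are checked in one direction only. *)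
Lemma straight_planar (G : sgraph) (pos : G -> R * R) (dir : rel G) :
  injective pos ->
  (forall u v, adj u v -> dir u v || dir v u) ->
  (forall u v w t, dir u v -> 0 <= t <= 1 -> pos w = seg (pos u) (pos v) t ->
     w = u \/ w = v) ->
  (forall u v a b t s, dir u v -> dir a b -> 0 <= t <= 1 -> 0 <= s <= 1 ->
     seg (pos u) (pos v) t = seg (pos a) (pos b) s ->
     (u = a /\ v = b) \/ exists w, pos w = seg (pos u) (pos v) t) ->
  planar R G.
Proof.
move=> posI dirP onV onE.
(* Taking all segments between members of [E] avoids ordering its ends; the degenerate segments add
   only the ends. *)
pose arc (E : {set G}) := [set x | exists u v t, [/\ u \in E, v \in E, 0 <= t <= 1
  & x = seg (pos u) (pos v) t]].
have arcE u v : arc [set u; v]%SET = seg (pos u) (pos v) @` `[0, 1].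
  apply/seteqP; split=> x; last first.
    case=> t; rewrite /= in_itv /= => t01 <-; exists u, v, t.
    by rewrite !inE !eqxx orbT.
  case=> a [b [t [+ + t01 ->]]]; rewrite !inE => /orP[]/eqP-> /orP[]/eqP->.
  - by exists 0; rewrite ?seg0 ?segxx //= in_itv /= lexx ler01.
  - by exists t; rewrite //= in_itv.
  - exists (1 - t); last by rewrite -segC.
    by rewrite /= in_itv /= subr_ge0 gerBl andbC.
  - by exists 1; rewrite ?seg1 ?segxx //= in_itv /= lexx ler01.
have edgeP E : E \in edges G -> exists u v, dir u v /\ E = [set u; v]%SET.
  rewrite inE => /existsP[u /existsP[v /andP[/dirP/orP[d|d] /eqP->]]].
    by exists u, v.
  by exists v, u; split=> //; rewrite finset.setUC.
exists pos, arc; split=> //.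
- move=> u v auv; rewrite arcE; apply: seg_arc.
  by apply: contraTneq auv => /posI->; rewrite adj_irrefl.
- move=> E w /edgeP[u [v [d ->]]]; rewrite arcE => -[t]; rewrite /= in_itv /= => t01 tw.
  by case: (onV u v w t d t01 (esym tw)) => ->; rewrite !inE eqxx ?orbT.
- move=> E F /edgeP[u [v [d ->]]] /edgeP[a [b [d' ->]]] ne x; rewrite !arcE.
  move=> [[t + tx] [s + sx]]; rewrite /= !in_itv /= => t01 s01.
  case: (onE u v a b t s d d' t01 s01); first by rewrite tx sx.
    by case=> ua vb; rewrite ua vb eqxx in ne.
  by case=> w wx; exists w => //; rewrite wx.
Qed.

End StraightLine.

(** * A plane drawing of the necklace *)

Section NecklacePlanar.
Local Open Scope ring_scope.
Variables (R : realType) (i D : nat).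
Hypothesis i_gt0 : (0 < i)%N.
Notation V := (necklace_vertex i D).
Implicit Types (u v w a b : V) (t s : R).

(** The depth below the line of slope [(copy v).+1] through the hub, which is the origin. It tells
    branches apart and vanishes only at the hub and at the last level, so that just the closing edge
    runs along the line. *)
Definition sag v : R :=
  if (level v == 0)%N || (level v == 2 * i)%N then 0
  else if odd (level v) then (branch v).+1%:R / (2 * D).+2%:R else 1 / 2%:R.

Definition place v : R * R :=
  ((level v)%:R, (level v)%:R * (copy v).+1%:R - sag v).

Definition dir : rel V := fun u v => necklace_adj u v && (level u < level v)%N.

Lemma dirP u v : dir u v -> [/\ (0 < level v)%N, level u = 0%N \/ copy u = copy v
  & level v = (level u).+1 \/ level u = 0%N /\ level v = (2 * i)%N].
Proof.
case/andP=> /adjP[lk st] lt; split; first by apply: leq_ltn_trans lt.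
  case/or3P: lk => /eqP; [by left|by move=> v0; rewrite v0 in lt|by right].
by case: st => [|E|/=|[_ E]]; [left|rewrite E ltnNge leqnSn in lt|right|rewrite E in lt].
Qed.

Lemma sag_ge0 v : 0 <= sag v.
Proof. by rewrite /sag; case: ifP => // _; case: ifP => _; [rewrite divr_ge0|lra]. Qed.

Lemma sag_lt1 v : sag v < 1.
Proof.
rewrite /sag; case: ifP => _; first by rewrite ltr01.
case: ifP => _; last lra.
by rewrite ltr_pdivrMr ?ltr0n // mul1r ltr_nat !ltnS branch_le.
Qed.

Lemma sag_end v : level v = 0%N \/ level v = (2 * i)%N -> sag v = 0.
Proof. by rewrite /sag => -[->|->]; rewrite eqxx ?orbT. Qed.

Lemma sag_eq0 v : sag v = 0 -> level v = 0%N \/ level v = (2 * i)%N.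
Proof.
rewrite /sag; case: ifP => [/orP[]/eqP->|_]; [by left|by right|].
case: ifP => _; last by move=> h; exfalso; lra.
move=> /eqP; by rewrite mulf_eq0 invr_eq0 !pnatr_eq0.
Qed.

Lemma sag_lt_level v : (0 < level v)%N -> sag v < (level v)%:R.
Proof. by move=> v0; apply: lt_le_trans (sag_lt1 v) _; rewrite ler1n. Qed.

Lemma sag_inj u v : level u = level v -> copy u = copy v -> sag u = sag v -> u = v.
Proof.
move=> luv cuv suv; apply: vertex_eq => //.
have [od|ev] := boolP (odd (level u)); last by rewrite !branch0 -?luv.
move: suv; rewrite /sag -luv od.
have -> : (level u == 0)%N || (level u == 2 * i)%N = false.
  by apply/negP=> /orP[]/eqP E; rewrite E ?oddM in od.
move/(mulIf _)/eqP; rewrite eqr_nat eqSS => /(_ _)/eqP; apply.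
by rewrite invr_eq0 pnatr_eq0.
Qed.

Lemma hub_eq u v : level u = 0%N -> level v = 0%N -> u = v.
Proof. by move=> lu lv; apply: even_vertex_eq; rewrite ?lu ?lv // /linked lu. Qed.

(* Points of copy [c] lie in the cone [c * X < Y <= c.+1 * X], so different
   copies only meet at the origin. *)
Lemma cone_inj (X h h' : R) (c c' : nat) : 0 <= h < X -> 0 <= h' < X ->
  X * c.+1%:R - h = X * c'.+1%:R - h' -> c = c' /\ h = h'.
Proof.
wlog cc : c c' h h' / (c <= c')%N.
  move=> H hX hX' E; case: (leqP c c') => [|/ltnW] le; first exact: H.
  by have [-> ->] := H _ _ _ _ le hX' hX (esym E).
move=> /andP[h0 hX] /andP[h0' hX'] E.
have cE : c = c'.
  apply/eqP; rewrite eqn_leq cc leqNgt; apply/negP=> lt.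
  have : (c.+1%:R : R) + 1 <= c'.+1%:R by rewrite natr1 ler_nat.
  nra.
by split=> //; move: E; rewrite cE; lra.
Qed.

Lemma seg_place u v t : dir u v ->
  let X := (1 - t) * (level u)%:R + t * (level v)%:R in
  seg (place u) (place v) t =
  (X, X * (copy v).+1%:R - ((1 - t) * sag u + t * sag v)).
Proof.
case/dirP=> _ cu _ X; rewrite /seg /place /=; congr pair.
have -> : (level u)%:R * (copy u).+1%:R = (level u)%:R * (copy v).+1%:R :> R.
  by case: cu => ->; rewrite ?mul0r.
by rewrite /X; ring.
Qed.

(** Away from the hub an edge stays inside the cone of its copy, as [cone_inj] requires. *)
Lemma seg_sag u v t : dir u v -> 0 <= t <= 1 ->
  let X := (1 - t) * (level u)%:R + t * (level v)%:R in
  X = 0 /\ t = 0 /\ level u = 0%N \/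
  0 < X /\ 0 <= (1 - t) * sag u + t * sag v < X.
Proof.
case/dirP=> v0 cu _ /andP[t0 t1] X.
have sv := sag_lt_level v0; have su0 := sag_ge0 u; have sv0 := sag_ge0 v.
have lv1 : 1 <= (level v)%:R :> R by rewrite ler1n.
case: (posnP (level u)) => [u0|u0]; last first.
  have su := sag_lt_level u0.
  have lu1 : 1 <= (level u)%:R :> R by rewrite ler1n.
  have h1 : 0 <= (1 - t) * ((level u)%:R - 1) by apply: mulr_ge0; lra.
  have h2 : 0 <= t * ((level v)%:R - 1) by apply: mulr_ge0; lra.
  have h3 : 0 <= (1 - t) * sag u by apply: mulr_ge0; lra.
  have h4 : 0 <= t * sag v by apply: mulr_ge0; lra.
  have h5 : 0 < (1 - t) * ((level u)%:R - sag u) + t * ((level v)%:R - sag v).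
    have [->|tn] := eqVneq t 0; first lra.
    have tp : 0 < t by rewrite lt_def tn.
    by apply: ltr_wpDl; [apply: mulr_ge0; lra|apply: mulr_gt0; lra].
  by right; rewrite /X; split; [lra|apply/andP; split; lra].
have su : sag u = 0 by apply: sag_end; left.
rewrite /X su u0 !mulr0 !add0r; have [->|tn] := eqVneq t 0.
  by left; rewrite mul0r.
have tp : 0 < t by rewrite lt_def tn.
right; split; first by apply: mulr_gt0 => //; lra.
by rewrite ltr_pM2l // sv andbT; apply: mulr_ge0.
Qed.

Lemma place_inj : injective place.
Proof.
move=> u v [/eqP]; rewrite eqr_nat => /eqP luv.
case: (posnP (level u)) => [u0|u0]; first by move=> _; apply: hub_eq; rewrite -?luv.
rewrite -luv => /cone_inj[].
- by rewrite sag_ge0 sag_lt_level.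
- by rewrite sag_ge0 luv sag_lt_level -?luv.
- by move=> cuv suv; apply: sag_inj.
Qed.

(** Away from the hub, [w] lies in the copy of [v]. An edge between consecutive levels has integer
    first coordinates only at its ends; on a closing edge [w] has sag 0. *)
Lemma place_seg u v w t : dir u v -> 0 <= t <= 1 ->
  place w = seg (place u) (place v) t -> w = u \/ w = v.
Proof.
move=> d t01; rewrite seg_place //; case: (seg_sag d t01) => /=.
  case=> X0 [_ u0]; rewrite X0 => -[/eqP + _]; rewrite pnatr_eq0 => /eqP w0.
  by left; apply: hub_eq.
case=> X0 sX [wX wY]; have [v0 cu lv] := dirP d.
have w0 : (0 < level w)%N by rewrite -(ltr0n R) wX.
move: wY; rewrite wX => /cone_inj[||cw sw] //.
  by rewrite sag_ge0 -wX sag_lt_level.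
case/andP: t01 => t0 t1.
case: lv => [lv|[u0 lv]]; last first.
  right; apply: sag_inj => //; last first.
    by rewrite sw !sag_end ?lv; [ring|right|left].
  move: sw; rewrite !(sag_end (v := u)) ?(sag_end (v := v)); [|by right|by left].
  rewrite !mulr0 addr0 => /sag_eq0[E|->//]; by rewrite E in w0.
have lwt : (level w)%:R = (level u)%:R + t :> R.
  by rewrite wX lv -natr1; ring.
case: (ltngtP (level w) (level u)) => [lt|lt|lwu].
- have : (level w)%:R + 1 <= (level u)%:R :> R by rewrite natr1 ler_nat.
  by move=> ?; exfalso; lra.
- have : (level u)%:R + 1 <= (level w)%:R :> R by rewrite natr1 ler_nat.
  move=> ?; have t1E : t = 1 by lra.
  right; apply: sag_inj => //; last by rewrite sw t1E; ring.
  apply/eqP; rewrite -(eqr_nat R) wX lv t1E; apply/eqP; ring.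
- have t0E : t = 0 by move: lwt; rewrite lwu; lra.
  left; apply: sag_inj => //; last by rewrite sw t0E; ring.
  by case: cu => [E|->//]; rewrite -lwu in E; rewrite E in w0.
Qed.

(** Sag 0 occurs only at the levels 0 and [2 * i], which are not consecutive. *)
Lemma sag_step_eq0 a b s : level b = (level a).+1 -> 0 <= s <= 1 ->
  (1 - s) * sag a + s * sag b = 0 -> s = 0 \/ s = 1.
Proof.
move=> lb /andP[s0 s1] E.
have [->|sn0] := eqVneq s 0; first by left.
have [->|sn1] := eqVneq s 1; first by right.
have sp : 0 < s by rewrite lt_def sn0.
have sp' : 0 < 1 - s by rewrite subr_gt0 lt_def eq_sym sn1.
have sa := sag_ge0 a; have sb := sag_ge0 b.
have h1 : 0 <= (1 - s) * sag a by apply: mulr_ge0 => //; apply: ltW.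
have h2 : 0 <= s * sag b by apply: mulr_ge0.
have /eqP : (1 - s) * sag a = 0 by lra.
rewrite mulf_eq0 (gt_eqF sp') /= => /eqP/sag_eq0 la.
have /eqP : s * sag b = 0 by lra.
rewrite mulf_eq0 (gt_eqF sp) /= => /eqP/sag_eq0 lb'.
exfalso; have := level_le b; have := i_gt0; move: la lb'; rewrite lb.
by move: (level a) => n; clear; lia.
Qed.

(** Edges between consecutive levels that meet in their interiors span the same levels at the same
    parameter; their even ends coincide, and then equal sags identify the odd ends. A closing edge
    has sag 0 and meets these edges only at their ends. *)
Lemma seg_seg u v a b t s : dir u v -> dir a b -> 0 <= t <= 1 -> 0 <= s <= 1 ->
  seg (place u) (place v) t = seg (place a) (place b) s ->
  (u = a /\ v = b) \/ exists w, place w = seg (place u) (place v) t.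
Proof.
move=> d d' t01 s01 E.
have end_t : t = 0 \/ t = 1 -> (u = a /\ v = b) \/ exists w, place w = seg (place u) (place v) t.
  by case=> ->; right; [exists u; rewrite seg0|exists v; rewrite seg1].
have end_s : s = 0 \/ s = 1 -> (u = a /\ v = b) \/ exists w, place w = seg (place u) (place v) t.
  by rewrite E; case=> ->; right; [exists a; rewrite seg0|exists b; rewrite seg1].
have := E; rewrite {1}(seg_place t d) (seg_place s d') => -[EX].
case: (seg_sag d t01) => /= [[_ [t0 _]]|[X0 HX]]; first by move=> _; apply: end_t; left.
case: (seg_sag d' s01) => /= [[_ [s0 _]]|[X0' HX']]; first by move=> _; apply: end_s; left.
rewrite -EX in HX' *; case/(cone_inj HX HX') => cvb sE.
have [v0 cu lv] := dirP d; have [b0 ca lb] := dirP d'.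
case: lv lb => [lv|[u0 lv]] [lb|[a0 lb]].
- have lus : (level u)%:R + t = (level a)%:R + s :> R.
    by move: EX; rewrite lv lb -!natr1; lra.
  have [t0 t1] := andP t01; have [s0 s1] := andP s01.
  case: (ltngtP (level u) (level a)) => [lt|lt|lua].
  + have : (level u)%:R + 1 <= (level a)%:R :> R by rewrite natr1 ler_nat.
    by move=> ?; apply: end_t; right; lra.
  + have : (level a)%:R + 1 <= (level u)%:R :> R by rewrite natr1 ler_nat.
    by move=> ?; apply: end_t; left; lra.
  have ts : s = t by move: lus; rewrite lua; lra.
  have [t0E|tn0] := eqVneq t 0; first by apply: end_t; left.
  have [t1E|tn1] := eqVneq t 1; first by apply: end_t; right.
  rewrite {}ts in sE; left.
  have lvb : level v = level b by rewrite lv lb lua.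
  have cua : copy u = copy a.
    case: (posnP (level u)) => u0; first by rewrite !copy0 -?lua.
    case: cu ca => [E0|->] [E0'|->] //; first by rewrite E0 in u0.
    + by rewrite E0 in u0.
    + by rewrite lua E0' in u0.
  have [ou|eu] := boolP (odd (level u)).
    have vb : v = b.
      apply: even_vertex_eq => //; first by rewrite lv /= ou.
      by rewrite /linked cvb eqxx !orbT.
    split=> //; apply: sag_inj => //; apply: (mulfI (x := 1 - t)).
      by rewrite subr_eq0 eq_sym.
    by move: sE; rewrite vb => /addIr.
  have ua : u = a by apply: even_vertex_eq => //; rewrite /linked cua eqxx !orbT.
  split=> //; apply: sag_inj => //; apply: (mulfI tn0).
  by move: sE; rewrite ua => /addrI.
- apply: end_t; apply: (sag_step_eq0 lv t01); rewrite sE !sag_end; [ring|by right|by left].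
- apply: end_s; apply: (sag_step_eq0 lb s01); rewrite -sE !sag_end; [ring|by right|by left].
- left; split; first exact: hub_eq.
  apply: even_vertex_eq; rewrite ?lv ?lb // ?oddM //.
  by rewrite /linked cvb eqxx !orbT.
Qed.

Lemma necklace_planar : planar R (necklace D i_gt0).
Proof.
apply: (@straight_planar R (necklace D i_gt0) place dir).
- exact: place_inj.
- move=> u v auv; have avu := etrans (necklace_adj_sym _ _) auv.
  rewrite /dir; rewrite /= in auv; rewrite auv avu /=; case: ltngtP => // luv.
  case/adjP: auv => _ []; rewrite luv; have := i_gt0; lia.
- exact: place_seg.
- exact: seg_seg.
Qed.

End NecklacePlanar.

(** * Obstruction sets *)

Section Obstructions.
Local Open Scope classical_set_scope.
Variable R : realType.

Definition odd_lengths : set nat := [set (2 * i + 1)%N | i in [set i : nat | (1 <= i)%N]].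

Lemma bool_colorable (G : sgraph) (D : nat) (c : G -> bool) :
  (forall v, (#|[set w | adj v w & c w == c v]%SET| <= D)%N) ->
  colorable (fun _ : 'I_2 => D) G.
Proof.
move=> cP; exists (fun v => if c v then ord0 else ord_max) => v.
apply: leq_trans (cP v); apply: subset_leq_card; apply/fintype.subsetP=> w.
by rewrite !inE => /andP[->]; case: (c v); case: (c w).
Qed.

Lemma odd_lengths_obstruction : obstruction_set R odd_lengths.
Proof.
split; first by move=> _ [i /= i1 <-] /=; lia.
exists 0%N => G [_ noodd].
have [c ucy|c cP] := @no_odd_cycle_bipartite G adj (@adj_sym G); last first.
  apply: (bool_colorable (c := c)) => v; rewrite leqn0 cards_eq0; apply/eqP/setP=> w.
  by rewrite !inE; apply/negP=> /andP[/cP]; rewrite eq_sym => /negPf->.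
apply/negP=> oc; case: (leqP 3 (size c)) => [c3|].
  apply: (noodd (size c)); last by exists c.
  exists (size c)./2; first by move: c3; rewrite -divn2 /=; lia.
  by rewrite mul2n addnC -[RHS]odd_double_half oc.
(* [ucycle] admits a list of length 1, which would be a loop. *)
case: c ucy oc => [|x [|y [|z c]]] //= /andP[/= + _] _.
by rewrite andbT adj_irrefl.
Qed.

Lemma four_obstruction : obstruction_set R [set 4%N].
Proof.
split; first by move=> _ ->.
exists light => G [pG no4].
have c4 : c4_free (@adj G).
  move=> u v x y uv xy ux uy vx; apply/negP=> vy; apply: (no4 4%N) => //.
  have ne (a b : G) : adj a b -> a != b by apply: contraTneq => ->; rewrite adj_irrefl.
  exists [:: u; x; v; y]; split=> //; apply/andP; split.
    by rewrite /= ux vy adj_sym vx adj_sym uy.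
  rewrite /= !inE !negb_or uv xy (ne _ _ ux) (ne _ _ uy) (eq_sym x) (ne _ _ vx).
  by rewrite (ne _ _ vy).
have [c cP] := c4_free_defective_coloring (@adj_sym G) (@adj_irrefl G) c4 (planar_drawing pG).
exact: bool_colorable cP.
Qed.

(** If 4 and [2 * i + 1] were both missing from [X], the necklace for this [i] and the bound [D] of
    [X] would avoid [X] without being colourable. *)
Lemma obstruction_set_cases (X : set nat) : obstruction_set R X ->
  X 4%N \/ odd_lengths `<=` X.
Proof.
move=> [X3 [D DP]]; have [|nX4] := pselect (X 4%N); [by left|right].
move=> _ [i /= i1 <-]; apply: contrapT => nXi.
apply: (@necklace_not_colorable i D i1); apply: DP; split; first exact: necklace_planar.
move=> k Xk /(necklace_cycles (X3 k Xk))[] E; [apply: nX4|apply: nXi]; by rewrite -E.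
Qed.

End Obstructions.

Local Open Scope classical_set_scope.

Theorem theorem2p1 (R : realType) (X : set nat) :
  minimal_obstruction_set R X <->
  X = [set (2 * i + 1)%N | i in [set i : nat | (1 <= i)%N]] \/
  X = [set 4%N].
Proof.
split=> [[oX minX]|[]->].
- have [X4|Xodd] := obstruction_set_cases oX; [right|left]; apply/esym/minX => //.
  + exact: four_obstruction.
  + by move=> _ ->.
  + exact: odd_lengths_obstruction.
- split; first exact: odd_lengths_obstruction.
  move=> Y oY Yodd; apply/seteqP; split=> //.
  have [/Yodd[i _ i4]|//] := obstruction_set_cases oY.
  by have := congr1 odd i4; rewrite addn1 /= oddM.
- split; first exact: four_obstruction.
  move=> Y oY Y4; apply/seteqP; split=> // _ ->.
  have [//|oddY] := obstruction_set_cases oY.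
  have /Y4 : Y 3%N by apply: oddY; exists 1%N.
  by [].
Qed.
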